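(* For each positive integer $n$, the partial annular semigroup $P\mathfrak{A}_{2n-1}$ and the annular semigroup $\mathfrak{A}_{2n-1}$ satisfy $c(P\mathfrak{A}_{2n-1})=c(\mathfrak{A}_{2n-1})=n-1$, where $c$ denotes Krohn--Rhodes complexity.
   Context: All semigroups are finite. Krohn--Rhodes complexity: a semigroup $S$ divides $T$ if $S$ is a homomorphic image of a subsemigroup of $T$. The (group or Krohn--Rhodes) complexity $c(S)$ is the least integer $m\ge 0$ such that $S$ divides an iterated wreath product $A_m\wr G_m\wr A_{m-1}\wr\cdots\wr A_1\wr G_1\wr A_0$, where the $G_i$ are finite groups and the $A_i$ are finite aperiodic semigroups (all of whose subgroups are trivial). (Here one may take $S\wr T=S^{T^I}\rtimes T$, where $T^I$ is $T$ with a new identity adjoined, with $(f,t)(g,u)=(h,tu)$, $h(x)=f(x)g(xt)$, and bracket iterated products to the right.) (Partial) Brauer semigroup: for a positive integer $n$ let $[n]=\{1,\dots,n\}$, $[n]'=\{1',\dots,n'\}$, $[n]''=\{1'',\dots,n''\}$ be disjoint copies. The partition semigroup $\mathfrak{C}_n$ consists of all partitions (equivalently, equivalence relations) of $[n]\cup[n]'$. The product $\xi\eta$ is computed as follows: let $\eta'$ be the equivalence relation on $[n]'\cup[n]''$ obtained from $\eta$ by replacing each $k$ by $k'$ and each $k'$ by $k''$; take the equivalence relation on $[n]\cup[n]'\cup[n]''$ generated by $\xi\cup\eta'$; restrict it to $[n]\cup[n]''$; finally replace each $k''$ by $k'$. This makes $\mathfrak{C}_n$ a monoid. The Brauer semigroup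 $\mathfrak{B}_n$ (respectively partial Brauer semigroup $P\mathfrak{B}_n$) is the subsemigroup of all elements all of whose blocks have size exactly $2$ (respectively at most $2$). (Partial) annular semigroup: consider the annulus $A=\{z\in\mathbb{C}\mid 1<|z|<2\}$ and identify $k\in[n]$ with $e^{2\pi i(k-1)/n}$ and $k'\in[n]'$ with $2e^{2\pi i(k-1)/n}$. An annular diagram of $\xi\in P\mathfrak{B}_n$ is obtained by linking, for each block $\{x,y\}\in\xi$ with $x\neq y$, the points $x$ and $y$ by a path (string) running entirely in $A$ except for its endpoints. The annular semigroup $\mathfrak{A}_n$ (respectively partial annular semigroup $P\mathfrak{A}_n$) is the subsemigroup of $\mathfrak{B}_n$ (respectively $P\mathfrak{B}_n$) consisting of all elements that have an annular diagram in which any two distinct strings have empty intersection. *)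

(* Defs.v *)
From HB Require Import structures.
From mathcomp Require Import all_boot all_order all_algebra all_fingroup.
From mathcomp Require Import all_classical all_reals all_analysis.
From mathcomp Require Import complex.

Set Implicit Arguments.
Unset Strict Implicit.
Unset Printing Implicit Defensive.

Import Order.TTheory GRing.Theory Num.Theory numFieldNormedType.Exports.

(* MathComp has no join of finType and semigroupType, and one can no longer be
   inserted below finGroupType, hence this bundled record. *)
Record finSemigroup := FinSemigroup {
  sg_sort :> finType;
  sg_mul : sg_sort -> sg_sort -> sg_sort;
  sg_mulA : associative sg_mul }.

Declare Scope sg_scope.
Delimit Scope sg_scope with sg.
Notation "x ** y" := (sg_mul x y)
  (at level 40, left associativity) : sg_scope.
Local Open Scope sg_scope.

Definition group_sg (G : finGroupType) : finSemigroup :=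
  FinSemigroup (@mulgA G).

Definition subsemigroup (S : finSemigroup) (A : {set S}) : Prop :=
  forall x y, x \in A -> y \in A -> x ** y \in A.

Definition subgroup (S : finSemigroup) (H : {set S}) : Prop :=
  subsemigroup H /\
  exists2 e, e \in H & forall x, x \in H ->
    [/\ e ** x = x, x ** e = x &
        exists2 y, y \in H & x ** y = e /\ y ** x = e].

Definition aperiodic (S : finSemigroup) : Prop :=
  forall H : {set S}, subgroup H -> #|H| = 1.

Section Wreath.
Variables S T : finSemigroup.

(* [option T] is T with a new identity [None] adjoined: [actI x t] is the
   product x t for x in T^I and t in T. *)
Definition actI (x : option T) (t : T) : option T :=
  if x is Some y then Some (y ** t) else Some t.

Definition wreath_mul (p q : {ffun option T -> S} * T) :
    {ffun option T -> S} * T :=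
  ([ffun x => p.1 x ** q.1 (actI x p.2)], p.2 ** q.2).

Lemma wreath_mulA : associative wreath_mul.
Proof.
move=> [f t] [g u] [h v]; rewrite /wreath_mul /= sg_mulA; congr pair.
by apply/ffunP => x; rewrite !ffunE sg_mulA; case: x => [y|] //=; rewrite sg_mulA.
Qed.

Definition wreath : finSemigroup := FinSemigroup wreath_mulA.

End Wreath.

(* [kr_product m W]: W is of the form
   A_m wr (G_m wr (A_(m-1) wr ( ... (A_1 wr (G_1 wr A_0)) ... ))). *)
Inductive kr_product : nat -> finSemigroup -> Prop :=
| kr_product0 A0 :
    aperiodic A0 -> kr_product 0 A0
| kr_productS m W (A : finSemigroup) (G : finGroupType) :
    kr_product m W -> aperiodic A ->
    kr_product m.+1 (wreath A (wreath (group_sg G) W)).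

(* The subsemigroup A of the ambient semigroup S divides T: A is the image of a
   homomorphism defined on a subsemigroup U of T (the values of phi outside U
   are irrelevant). *)
Definition divides (S : finSemigroup) (A : {set S}) (T : finSemigroup) : Prop :=
  exists (U : {set T}) (phi : T -> S),
    [/\ subsemigroup U,
        forall u v, u \in U -> v \in U -> phi (u ** v) = phi u ** phi v &
        phi @: U = A].

(* That A is a subsemigroup need not be assumed separately. *)
Lemma divides_subsemigroup (S : finSemigroup) (A : {set S}) T :
  divides A T -> subsemigroup A.
Proof.
move=> [U [phi [clU phiM <-]]] _ _ /imsetP[u uU ->] /imsetP[v vU ->].
by rewrite -phiM //; apply/imset_f/clU.
Qed.

Definition kr_bound (S : finSemigroup) (A : {set S}) (m : nat) : Prop :=
  exists2 W, kr_product m W & divides A W.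

(* c(A) = m, for a subsemigroup A of S. *)
Definition kr_complexity (S : finSemigroup) (A : {set S}) (m : nat) : Prop :=
  kr_bound A m /\ forall k, kr_bound A k -> m <= k.

(* [inl k] is the point k of [n], [inr k] is the point k' of [n]'. *)
Definition vertex (n : nat) := ('I_n + 'I_n)%type.

Definition equivalenceb (T : finType) (E : {set T * T}) : bool :=
  [&& [forall x, (x, x) \in E],
      [forall x, forall y, ((x, y) \in E) ==> ((y, x) \in E)] &
      [forall x, forall y, forall z,
        ((x, y) \in E) && ((y, z) \in E) ==> ((x, z) \in E)]].

Definition ptn (n : nat) : finType :=
  {E : {set vertex n * vertex n} | equivalenceb E}.

Definition blocks (n : nat) (xi : ptn n) : {set {set vertex n}} :=
  equivalence_partition (fun x y => (x, y) \in val xi) [set: vertex n].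

Section GeneratedEquivalence.

(* Reflexive transitive closure. It is the equivalence relation generated by E
   when E is symmetric, as are the relations it is used for below. *)
Definition generated (T : finType) (E : {set T * T}) : rel T :=
  connect (fun x y => (x, y) \in E).

Definition push (T U : finType) (f : T -> U) (E : {set T * T}) : {set U * U} :=
  [set (f p.1, f p.2) | p in E].

Lemma equivalencebP (T : finType) (E : {set T * T}) :
  reflect [/\ forall x, (x, x) \in E,
              forall x y, (x, y) \in E -> (y, x) \in E &
              forall x y z, (x, y) \in E -> (y, z) \in E -> (x, z) \in E]
          (equivalenceb E).
Proof.
apply: (iffP and3P) => -[r s t]; split.
- exact/forallP.
- by move=> x y; move/forallP/(_ x)/forallP/(_ y)/implyP: s.
- move=> x y z xy yz.
  by move/forallP/(_ x)/forallP/(_ y)/forallP/(_ z)/implyP: t; rewrite xy yz => ->.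
- exact/forallP.
- by apply/forallP => x; apply/forallP => y; apply/implyP/s.
- apply/forallP => x; apply/forallP => y; apply/forallP => z.
  by apply/implyP => /andP[]; apply: t.
Qed.

Lemma generated_min (T : finType) (E : {set T * T}) (Q : T -> T -> Prop) :
  (forall x, Q x x) -> (forall x y z, Q x y -> (y, z) \in E -> Q x z) ->
  forall x y, generated E x y -> Q x y.
Proof.
move=> Q0 QS x y /connectP[p]; elim/last_ind: p y => [|p z IH] y /=.
  by move=> _ ->.
rewrite rcons_path last_rcons => /andP[xp pz] ->.
by apply: QS pz; apply: IH.
Qed.

Lemma generated_sub (T : finType) (E F : {set T * T}) :
  (forall x y, (x, y) \in E -> generated F x y) ->
  forall x y, generated E x y -> generated F x y.
Proof.
move=> EF; apply: generated_min => [x|x y z xy /EF]; first exact: connect0.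
exact: connect_trans.
Qed.

Lemma push_in (T U : finType) (f : T -> U) (E : {set T * T}) x y :
  (x, y) \in E -> (f x, f y) \in push f E.
Proof. by move=> xy; apply/imsetP; exists (x, y). Qed.

Lemma push_comp (T U W : finType) (f : T -> U) (g : U -> W) E :
  push g (push f E) = push (g \o f) E.
Proof. by rewrite /push -imset_comp. Qed.

Lemma pushU (T U : finType) (f : T -> U) E F :
  push f (E :|: F) = push f E :|: push f F.
Proof. exact: imsetU. Qed.

Lemma generated_push_inv (T U : finType) (f : T -> U) E a b :
  injective f -> generated (push f E) a b ->
  a = b \/ exists x y, [/\ a = f x, b = f y & generated E x y].
Proof.
move=> fI; move: a b; apply: generated_min => [a|a b c IH]; first by left.
move=> /imsetP[[x y] /= xy [bx ->]]; right; case: IH => [->|[u [v [-> bv uv]]]].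
  by exists x, y; split => //; apply: connect1.
exists u, y; split => //; apply: connect_trans uv _.
by move: bv; rewrite bx => /fI <-; apply: connect1.
Qed.

Lemma generated_push (T U : finType) (f : T -> U) E x y :
  injective f -> generated (push f E) (f x) (f y) = generated E x y.
Proof.
move=> fI; apply/idP/idP.
  move/(generated_push_inv fI) => [/fI ->|[u [v [/fI -> /fI -> //]]]].
  exact: connect0.
move: x y; apply: generated_min => [x|x y z xy yz]; first exact: connect0.
by apply: connect_trans xy _; apply/connect1/push_in.
Qed.

(* Hiding the points outside P in a first step, then closing up, amounts to
   closing up at once. *)
Lemma generated_amalgam (T : finType) (P : pred T) (E D F : {set T * T}) :
  (forall a b, (a, b) \in F -> P a && P b) ->
  (forall a b, (a, b) \in D -> generated E a b) ->
  (forall a b, P a -> P b -> generated E a b -> generated D a b) ->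
  forall a b, P a -> P b -> generated (E :|: F) a b = generated (D :|: F) a b.
Proof.
move=> FP DE ED a b Pa Pb; apply/idP/idP; last first.
  apply: generated_sub => x y; rewrite inE => /orP[/DE|xy].
    by apply: generated_sub => u v uv; apply: connect1; rewrite inE uv.
  by apply: connect1; rewrite inE xy orbT.
have Dsub x y : generated D x y -> generated (D :|: F) x y.
  by apply: generated_sub => u v uv; apply: connect1; rewrite inE uv.
suff: forall x y, generated (E :|: F) x y ->
    P x -> exists c, [/\ P c, generated (D :|: F) x c & generated E c y].
  move=> /(_ a b) h /h /(_ Pa) [c [Pc ac cb]].
  by apply: connect_trans ac _; apply/Dsub/ED.
apply: generated_min => [x Px|x y z IH]; first by exists x; split => //; apply: connect0.
rewrite inE => /orP[] yz /IH [c [Pc xc cy]].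
  by exists c; split => //; apply: connect_trans cy _; apply: connect1.
have /andP[Py Pz] := FP _ _ yz.
exists z; split => //; last exact: connect0.
apply: connect_trans xc _; apply: (connect_trans (Dsub _ _ (ED _ _ Pc Py cy))).
by apply: connect1; rewrite inE yz orbT.
Qed.

End GeneratedEquivalence.

Section PartitionProduct.
Variable n : nat.

(* The disjoint union of [n], [n]' and [n]'', in this order. *)
Definition vertex3 := ('I_n + 'I_n + 'I_n)%type.

Definition upper (x : vertex n) : vertex3 := inl x.

Definition lower (x : vertex n) : vertex3 :=
  match x with inl k => inl (inr k) | inr k => inr k end.

Definition outer (x : vertex n) : vertex3 :=
  match x with inl k => inl (inl k) | inr k => inr k end.

Definition glue (E F : {set vertex n * vertex n}) : {set vertex3 * vertex3} :=
  push upper E :|: push lower F.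

Definition compose (E F : {set vertex n * vertex n}) :
    {set vertex n * vertex n} :=
  [set p | generated (glue E F) (outer p.1) (outer p.2)].

Lemma push_sym (T U : finType) (f : T -> U) (E : {set T * T}) a b :
  equivalenceb E -> (a, b) \in push f E -> (b, a) \in push f E.
Proof.
by move=> /equivalencebP[_ sE _] /imsetP[[x y] xy [-> ->]]; apply/push_in/sE.
Qed.

Lemma compose_equiv (E F : {set vertex n * vertex n}) :
  equivalenceb E -> equivalenceb F -> equivalenceb (compose E F).
Proof.
move=> eE eF; apply/equivalencebP; split => [x|x y|x y z]; rewrite !inE //=.
- exact: connect0.
- rewrite /generated sym_connect_sym // => a b.
  by apply/idP/idP; rewrite !inE => /orP[] /push_sym ->; rewrite ?orbT.
- exact: connect_trans.
Qed.

Definition ptn_mul (xi eta : ptn n) : ptn n :=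
  Sub (compose (val xi) (val eta)) (compose_equiv (valP xi) (valP eta)).

Let vertex4 := ('I_n + 'I_n + 'I_n + 'I_n)%type.

Let e012 (a : vertex3) : vertex4 := inl a.

Let e123 (a : vertex3) : vertex4 :=
  match a with
  | inl (inl k) => inl (inl (inr k)) | inl (inr k) => inl (inr k)
  | inr k => inr k
  end.

Let e023 (a : vertex3) : vertex4 :=
  match a with
  | inl (inl k) => inl (inl (inl k)) | inl (inr k) => inl (inr k)
  | inr k => inr k
  end.

Let e013 (a : vertex3) : vertex4 :=
  match a with
  | inl (inl k) => inl (inl (inl k)) | inl (inr k) => inl (inl (inr k))
  | inr k => inr k
  end.

Let lay1 (a : vertex4) : bool := if a is inl (inl (inr _)) then true else false.
Let lay2 (a : vertex4) : bool := if a is inl (inr _) then true else false.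

Let glue4 (E F G : {set vertex n * vertex n}) : {set vertex4 * vertex4} :=
  push (e012 \o upper) E :|: push (e012 \o lower) F :|: push (e123 \o lower) G.

Lemma composeAl E F G x y : ((x, y) \in compose (compose E F) G) =
  generated (glue4 E F G) (e023 (outer x)) (e023 (outer y)).
Proof.
have i023 : injective e023 by move=> [[?|?]|?] [[?|?]|?] // [->].
have i012 : injective e012 by move=> ? ? [].
rewrite inE -(generated_push _ _ _ i023) pushU !push_comp /glue4.
rewrite -(push_comp upper e012) -(push_comp lower e012) -pushU -/(glue E F).
have -> : push (e123 \o lower) G = push (e023 \o lower) G.
  by apply: eq_imset => -[[k|k] [l|l]].
apply/esym/(@generated_amalgam _ (predC lay1)); last 2 first.
- by case: x.
- by case: y.
- by move=> a b /imsetP[[[k|k] [l|l]] _ [-> ->]].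
- move=> a b /imsetP[[u v]]; rewrite inE => uv [-> ->].
  move: uv; rewrite -(generated_push _ _ _ i012).
  by case: u v => [k|k] [l|l].
- move=> a b Pa Pb /(generated_push_inv i012) [->|[u [v [ae be uv]]]].
    exact: connect0.
  have [u' u'E] : exists u', u = outer u'.
    by case: u ae Pa {uv} => [[k|k]|k] -> // _; [exists (inl k)|exists (inr k)].
  have [v' v'E] : exists v', v = outer v'.
    by case: v be Pb {uv} => [[k|k]|k] -> // _; [exists (inl k)|exists (inr k)].
  apply: connect1; apply/imsetP; exists (u', v'); first by rewrite inE -u'E -v'E.
  by rewrite ae be u'E v'E; case: (u') (v') => [k|k] [l|l].
Qed.

Lemma composeAr E F G x y : ((x, y) \in compose E (compose F G)) =
  generated (glue4 E F G) (e023 (outer x)) (e023 (outer y)).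
Proof.
have i013 : injective e013 by move=> [[?|?]|?] [[?|?]|?] // [->].
have i123 : injective e123 by move=> [[?|?]|?] [[?|?]|?] // [->].
rewrite inE -(generated_push _ _ _ i013) pushU !push_comp /glue4.
have -> : push (e012 \o lower) F = push (e123 \o upper) F.
  by apply: eq_imset => -[[k|k] [l|l]].
have -> : push (e012 \o upper) E = push (e013 \o upper) E.
  by apply: eq_imset => -[[k|k] [l|l]].
rewrite -finset.setUA -(push_comp upper e123) -(push_comp lower e123) -pushU -/(glue F G).
rewrite ![push (e013 \o upper) E :|: _]finset.setUC.
have -> : e023 (outer x) = e013 (outer x) by case: x.
have -> : e023 (outer y) = e013 (outer y) by case: y.
apply/esym/(@generated_amalgam _ (predC lay2)); last 2 first.
- by case: x.
- by case: y.
- by move=> a b /imsetP[[[k|k] [l|l]] _ [-> ->]].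
- move=> a b /imsetP[[u v]]; rewrite inE => uv [-> ->].
  move: uv; rewrite -(generated_push _ _ _ i123).
  by case: u v => [k|k] [l|l].
- move=> a b Pa Pb /(generated_push_inv i123) [->|[u [v [ae be uv]]]].
    exact: connect0.
  have [u' u'E] : exists u', u = outer u'.
    by case: u ae Pa {uv} => [[k|k]|k] -> // _; [exists (inl k)|exists (inr k)].
  have [v' v'E] : exists v', v = outer v'.
    by case: v be Pb {uv} => [[k|k]|k] -> // _; [exists (inl k)|exists (inr k)].
  apply: connect1; apply/imsetP; exists (u', v'); first by rewrite inE -u'E -v'E.
  by rewrite ae be u'E v'E; case: (u') (v') => [k|k] [l|l].
Qed.

Lemma ptn_mulA : associative ptn_mul.
Proof.
move=> xi eta zeta; apply/val_inj/setP => -[x y] /=.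
by rewrite composeAl composeAr.
Qed.

Definition partition_sg : finSemigroup := FinSemigroup ptn_mulA.

End PartitionProduct.

Definition partial_brauer (n : nat) : {set partition_sg n} :=
  [set xi | [forall B in blocks xi, #|B| <= 2]].

Definition brauer (n : nat) : {set partition_sg n} :=
  [set xi | [forall B in blocks xi, #|B| == 2]].

Local Open Scope ring_scope.

(* The complex numbers over R, as a numFieldType: this is where they get their
   topology from. *)
Definition cplx (R : realType) : numFieldType := R[i].

Definition expi (R : realType) (t : R) : cplx R := (cos t +i* sin t)%C.

Definition annulus (R : realType) : set (cplx R) :=
  [set z | 1 < `|z| < 2]%classic.

(* Ordinals start at 0, so that [k : 'I_n] stands for the integer k + 1. *)
Definition node (R : realType) (n : nat) (x : vertex n) : cplx R :=
  match x with
  | inl k => expi (2 * pi * k%:R / n%:R)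
  | inr k => 2 * expi (2 * pi * k%:R / n%:R)
  end.

(* g, restricted to [0, 1], is a string linking the points x and y. *)
Definition is_string (R : realType) (n : nat) (x y : vertex n)
    (g : R -> cplx R) : Prop :=
  [/\ {within `[0, 1], continuous g}%classic,
      g 0 = node R x, g 1 = node R y &
      forall t : R, 0 < t < 1 -> annulus (g t)].

Definition trace (R : realType) (g : R -> cplx R) : set (cplx R) :=
  (g @` `[0, 1])%classic.

(* The diagram d assigns a string to each block with two elements (its values
   on the other sets are irrelevant). *)
Definition annular_diagram (R : realType) (n : nat) (xi : ptn n)
    (d : {set vertex n} -> R -> cplx R) : Prop :=
  forall B, B \in blocks xi -> #|B| = 2%N ->
    exists x y, [/\ x != y, B = [set x; y] & is_string x y (d B)].

Definition noncrossing (R : realType) (n : nat) (xi : ptn n)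
    (d : {set vertex n} -> R -> cplx R) : Prop :=
  forall B C, B \in blocks xi -> C \in blocks xi -> #|B| = 2%N -> #|C| = 2%N ->
    B != C -> (trace (d B) `&` trace (d C) = set0)%classic.

Definition is_annular (R : realType) (n : nat) (xi : ptn n) : Prop :=
  exists d : {set vertex n} -> R -> cplx R,
    annular_diagram xi d /\ noncrossing xi d.

Definition partial_annular (R : realType) (n : nat) : {set partition_sg n} :=
  [set xi in partial_brauer n | `[< is_annular R xi >]].

Definition annular (R : realType) (n : nat) : {set partition_sg n} :=
  [set xi in brauer n | `[< is_annular R xi >]].

(* Main.v *)
Require Import Defs.
From mathcomp Require Import all_boot all_order all_algebra all_fingroup.
From mathcomp Require Import all_classical all_reals all_analysis.
From mathcomp Require Import complex zify ring lra.

(** Write [N] for the odd degree 2n - 1, so that n - 1 = (N - 1) / 2. Both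
   semigroups contain the annular semigroup and lie in the partial Brauer
   semigroup of degree [N]. It suffices to bound the complexity of the latter
   from above and that of the former from below, and to see that the two
   semigroups of the theorem are closed under products.

   Upper bound. An element of the partial Brauer semigroup is either a partial
   permutation, or it has two vertices of the same side in one block and then
   factors through the corner [cut r] P [cut r] with r = N - 2, which is a
   partial Brauer semigroup of smaller odd degree ([nonrook_factor]). A long
   product is evaluated from left to right by a cascade of machines: a group
   machine multiplies the permutations, an aperiodic machine remembers the
   points that have been lost and the last factorisation met, and a machine for
   the corner multiplies what lies between consecutive factorisations. Thus two
   degrees cost one group ([computable_rank_le]). The recursion ends in degree 1,
   where everything is aperiodic.

   Lower bound. Let [rotp N r 1] turn the first r points by one step and join
   the other ones in pairs of neighbours, on both sides; its powers form a cyclic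
   group with identity [rotp N r 0]. If a semigroup divides an iterated
   wreath product, then each aperiodic level has a state that is fixed by
   preimages of the generators of this group and of the next smaller idempotent,
   and the elements that act trivially on a group level contain all idempotents.
   Each group level therefore only takes us from a semigroup containing
   [rotp N (s + 2) 1] and [rotp N s 0] to the part generated by its idempotents
   ([kr_product_stabiliser]); as s is odd, this part still contains
   [rotp N s 1] ([rot_descend]). There are (N - 1) / 2 nontrivial groups on the
   way from N to 3, hence as many group levels.

   Topology enters twice. Drawings of two elements are stacked by shrinking each
   of them to one half of the annulus; the strings that belong to the same block
   of the product are concatenated, and different blocks remain disjoint
   ([drawing_mul]). The two generators used in the lower bound, the rotation and
   the partition with one pair of neighbours joined on either side, are drawn by
   explicit formulas in polar coordinates. *)

Set Implicit Arguments.
Unset Strict Implicit.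
Unset Printing Implicit Defensive.

Local Open Scope sg_scope.

(** * Powers and aperiodic semigroups *)

Arguments sg_mul : simpl never.

Section Powers.
Variable S : finSemigroup.
Implicit Types (x y : S) (H : {set S}).

(** The power of exponent n + 1, as a semigroup has no power of exponent 0. *)
Definition spow x n : S := iter n (fun y => y ** x) x.

Lemma spowD x m n : spow x m ** spow x n = spow x (m + n).+1.
Proof.
elim: n => [|n IH]; first by rewrite addn0.
by rewrite addnS -[spow x n.+1]/(spow x n ** x) sg_mulA IH.
Qed.

Lemma spowS x n : spow x n.+1 = x ** spow x n.
Proof. by rewrite -[n.+1]/((0 + n).+1) -spowD. Qed.

Lemma spow_idem x n : x ** x = x -> spow x n = x.
Proof. by move=> xx; elim: n => //= n ->. Qed.

Lemma spowM x m n : spow (spow x m) n = spow x (n * m.+1 + m).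
Proof.
elim: n => // n IH; rewrite [LHS]/= IH spowD; congr spow.
by lia.
Qed.

Lemma spow_closed H x n : subsemigroup H -> x \in H -> spow x n \in H.
Proof. by move=> sH xH; elim: n => //= n IH; apply: sH. Qed.

(** By the pigeonhole principle the powers of [x] are eventually periodic; a large
   multiple of the period is an idempotent exponent. *)
Lemma idempotent_power x : exists n, spow x n ** spow x n = spow x n.
Proof.
have [i [d id]] : exists i d, spow x (i + d.+1) = spow x i.
  have /injectivePn[i [j ij eij]] :
      ~~ injectiveb (fun i : 'I_#|S|.+1 => spow x i).
    apply: contraT => /negbNE/injectiveP/leq_card.
    by rewrite card_ord ltnn.
  wlog lt : i j ij eij / i < j.
    move=> wl; have [lt|lt|/val_inj e] := ltngtP i j.
    - exact: (wl i j).
    - by apply: (wl j i) => //; rewrite eq_sym.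
    - by rewrite e eqxx in ij.
  by exists i, (j - i).-1; rewrite prednK ?subn_gt0 // subnKC ?(ltnW lt).
have per1 k : spow x (i + k + d.+1) = spow x (i + k).
  case: k => [|k]; first by rewrite addn0.
  have -> : i + k.+1 + d.+1 = (i + d.+1 + k).+1 by lia.
  by rewrite -spowD id spowD addnS.
have per k q : spow x (i + k + q * d.+1) = spow x (i + k).
  elim: q => [|q IH]; first by rewrite addn0.
  by rewrite mulSnr addnA -[in X in X + d.+1]addnA per1 addnA.
exists (i * d.+1 + d); rewrite spowD.
rewrite (_ : _.+1 = i + (i * d + d) + i.+1 * d.+1) ?per; last by lia.
by congr spow; lia.
Qed.

(** One exponent for all elements: the product of individual ones. *)
Lemma uniform_idempotent_power :
  exists n, forall x, spow x n ** spow x n = spow x n.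
Proof.
have [e eP] := fin_all_exists idempotent_power.
exists (\prod_x (e x).+1).-1 => x.
have -> : (\prod_x (e x).+1).-1 =
    (\prod_(y | y != x) (e y).+1).-1 * (e x).+1 + e x.
  rewrite (bigD1 x) //=.
  have : 0 < \prod_(y | y != x) (e y).+1 by apply: prodn_gt0.
  by case: (\prod_(y | _) _) => // q _; rewrite mulnC mulSn; lia.
by rewrite -spowM (spow_idem _ (eP x)).
Qed.

End Powers.

Section Aperiodic.
Variables S T : finSemigroup.

Lemma aperiodic_subgroup_eq (H : {set S}) x y :
  aperiodic S -> subgroup H -> x \in H -> y \in H -> x = y.
Proof.
move=> aS /aS/eqP/cards1P[z ->]; rewrite !inE => /eqP -> /eqP ->.
by [].
Qed.

Lemma subgroup_image (H : {set S}) (f : S -> T) :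
  subgroup H -> {in H &, {morph f : x y / x ** y}} -> subgroup (f @: H).
Proof.
move=> [cH [e eH eP]] fM; split=> [_ _ /imsetP[x xH ->] /imsetP[y yH ->]|].
  by rewrite -fM //; apply/imset_f/cH.
exists (f e); first exact: imset_f.
move=> _ /imsetP[x xH ->]; have [ex xe [y yH [xy yx]]] := eP x xH.
by split; rewrite -?fM ?ex ?xe //; exists (f y); rewrite ?imset_f // -!fM ?xy ?yx.
Qed.

Lemma aperiodic_idempotents : (forall x : S, x ** x = x) -> aperiodic S.
Proof.
move=> idS H [cH [e eH eP]]; apply/eqP/cards1P; exists e; apply/setP => x.
rewrite inE; apply/idP/eqP => [xH|-> //].
have [ex xe [y yH [xy yx]]] := eP x xH.
by rewrite -ex -yx -sg_mulA idS.
Qed.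

(** The products of an idempotent power [u] of [x] with the powers of [x] form a
   group with identity [u]. *)
Lemma aperiodic_power : aperiodic S ->
  exists n, forall x : S, spow x n ** spow x n = spow x n /\
    spow x n ** x = spow x n.
Proof.
move=> aS; have [n nP] := uniform_idempotent_power S.
exists n => x; split => //; set u := spow x n.
have ux : x ** u = u ** x by rewrite /u -spowS.
have uxk k : spow x k ** u = u ** spow x k by rewrite /u !spowD addnC.
have uu q : u ** spow x (q * n.+1 + n) = u by rewrite -spowM spow_idem /u nP.
pose H : {set S} := [set z | `[< exists k, z = u ** spow x k >]]%SET.
have inH k : u ** spow x k \in H by rewrite finset.in_set; apply/asboolP; exists k.
have uH : u \in H by have := inH n; rewrite -/u nP.
have MH j k : (u ** spow x j) ** (u ** spow x k) = u ** spow x (j + k).+1.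
  by rewrite sg_mulA -[u ** _ ** u]sg_mulA uxk sg_mulA nP -sg_mulA spowD.
have gH : subgroup H.
  split=> [y z|].
    rewrite !finset.in_set => /asboolP[j ->] /asboolP[k ->]; apply/asboolP;
    by exists (j + k).+1; rewrite MH.
  exists u => // y; rewrite finset.in_set => /asboolP[k ->]; split.
  - by rewrite sg_mulA nP.
  - by rewrite -sg_mulA uxk sg_mulA nP.
  exists (u ** spow x (k.+1 * n + n)) => //; rewrite !MH.
  by split; rewrite -[RHS](uu k.+1); congr (_ ** spow _ _); lia.
have xu : u ** spow x 0 = u by apply: (aperiodic_subgroup_eq aS gH).
exact: xu.
Qed.

End Aperiodic.

(** A subgroup of the wreath product projects to a trivial subgroup of [T], so its
   elements all have the second component of its identity [e]. Evaluation at a point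
   that this component fixes is then a homomorphism to [S]. *)
Lemma aperiodic_wreath (S T : finSemigroup) :
  aperiodic S -> aperiodic T -> aperiodic (wreath S T).
Proof.
move=> aS aT H gH; have [cH [e eH eP]] := gH.
have snd_eq (h : wreath S T) : h \in H -> h.2 = e.2.
  have gT : subgroup [set p.2 | p : wreath S T in H] by apply: subgroup_image.
  by move=> hH; apply: (aperiodic_subgroup_eq aT gT); apply/imset_f.
have idT : e.2 ** e.2 = e.2 by rewrite -{3}(snd_eq _ (cH _ _ eH eH)).
have fst_eq (h : wreath S T) x : h \in H -> h.1 (actI x e.2) = e.1 (actI x e.2).
  move=> hH.
  have gS : subgroup [set p.1 (actI x e.2) | p : wreath S T in H].
    apply: subgroup_image => // p q pH qH /=; rewrite ffunE (snd_eq _ pH).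
    by case: x => [x|] /=; rewrite -?sg_mulA idT.
  by apply: (aperiodic_subgroup_eq aS gS); apply/imset_f.
apply/eqP/cards1P; exists e; apply/setP => h; rewrite inE.
apply/idP/eqP => [hH|-> //].
have [eh _ _] := eP h hH; have [ee _ _] := eP e eH.
rewrite -eh -[RHS]ee; congr pair; last by rewrite (snd_eq _ hH).
by apply/ffunP => x; rewrite !ffunE fst_eq.
Qed.

(** * Sequential machines in iterated wreath products *)

Section Runs.
Variable Sigma : Type.
Implicit Types (h : seq Sigma) (s : Sigma).

(** The output of a machine with values in [S]. The history of inputs is a
   word read from right to left, so that the latest letter is its head; a letter
   may be translated into an element of [S] in a way that depends on what has
   been read before. *)
Fixpoint run (S : finSemigroup) (inp : seq Sigma -> Sigma -> S) h : option S :=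
  if h is s :: h' then actI (run inp h') (inp h' s) else None.

Lemma eq_run (S : finSemigroup) (i1 i2 : seq Sigma -> Sigma -> S) :
  (forall h s, i1 h s = i2 h s) -> run i1 =1 run i2.
Proof. by move=> E; elim=> //= s h ->; rewrite E. Qed.

Lemma run_neq0 (S : finSemigroup) (inp : seq Sigma -> Sigma -> S) s h :
  exists a, run inp (s :: h) = Some a.
Proof. by rewrite /=; case: (run inp h) => [a|] /=; eexists. Qed.

Definition first_of (S T : finSemigroup) (p : wreath S T) : S := p.1 None.

(** The state of the wreath product contains what the left machine would do from
   any state of the right one; the run from the initial state is its value at the
   adjoined identity. *)
Lemma run_cascade (S T : finSemigroup) (inp : seq Sigma -> Sigma -> T)
    (m : seq Sigma -> option T -> Sigma -> S) h :
  let r := run (fun h s => ([ffun x => m h x s], inp h s) : wreath S T) h in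
  omap snd r = run inp h /\
  omap (@first_of S T) r = run (fun h s => m h (run inp h) s) h.
Proof.
elim: h => //= s h []; case: (run _ h) => [[f v]|] /= <- <- /=.
  by rewrite /first_of /= !ffunE.
by rewrite /first_of /= !ffunE.
Qed.

(** An iterated wreath product with [k] group factors is [wreath B V] with a stem [V]
   and [B] aperiodic. Keeping the two apart allows [B] to grow. *)
Definition stem k (V : finSemigroup) : Prop :=
  if k is k'.+1 then
    exists (G : finGroupType) (W : finSemigroup),
      kr_product k' W /\ V = wreath (group_sg G) W
  else aperiodic V.

Lemma kr_product_stem k (V B : finSemigroup) :
  stem k V -> aperiodic B -> kr_product k (wreath B V).
Proof.
case: k => [|k] /= sV aB; first by constructor; apply: aperiodic_wreath.
by case: sV => G [W [kW ->]]; constructor.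
Qed.

(** [F] is a function of the state of an iterated wreath product with [k] group
   factors. *)
Definition computable k (Y : Type) (F : seq Sigma -> Y) : Prop :=
  exists (V : finSemigroup) (lam : Sigma -> V)
         (B : finSemigroup) (beta : option V -> Sigma -> B)
         (out : option V -> option B -> Y),
  [/\ stem k V, aperiodic B &
      forall h, F h = out (run (fun _ => lam) h)
        (run (fun h s => beta (run (fun _ => lam) h) s) h)].

Lemma computable_post k Y Z (F : seq Sigma -> Y) (f : Y -> Z) (F' : seq Sigma -> Z) :
  computable k F -> (forall h, F' h = f (F h)) -> computable k F'.
Proof.
move=> [V [lam [B [beta [out [sV aB FE]]]]]] F'E.
exists V, lam, B, beta, (fun v b => f (out v b)); split => // h.
by rewrite F'E FE.
Qed.

Definition bool_sg : finSemigroup := FinSemigroup andbA.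

Lemma aperiodic_bool : aperiodic bool_sg.
Proof. by apply: aperiodic_idempotents; case. Qed.

Lemma computable_const (Y : Type) (y : Y) : computable 0 (fun _ => y).
Proof.
exists bool_sg, (fun _ => true), bool_sg, (fun _ _ => true), (fun _ _ => y).
by split => //; apply: aperiodic_bool.
Qed.

(** The new machine joins the leftmost aperiodic factor, as a wreath product of
   aperiodic semigroups is aperiodic. *)
Lemma computable_aperiodic k Y (F : seq Sigma -> Y) (B : finSemigroup)
    (mu : Y -> Sigma -> B) : aperiodic B -> computable k F ->
  computable k (fun h => (F h, run (fun h s => mu (F h) s) h)).
Proof.
move=> aB [V [lam [C [beta [out [sV aC FE]]]]]].
exists V, lam, (wreath B C).
exists (fun v s => ([ffun c => mu (out v c) s], beta v s)).
exists (fun v p => (out v (omap snd p), omap (@first_of B C) p)).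
split; [by []|exact: aperiodic_wreath|move=> h].
have [-> ->] := run_cascade (fun h s => beta (run (fun _ => lam) h) s)
  (fun h c s => mu (out (run (fun _ => lam) h) c) s) h.
by rewrite FE; congr pair; apply: eq_run => h' s; rewrite FE.
Qed.

(** What was computed before becomes the right part of a new stem. *)
Lemma computable_group k Y (F : seq Sigma -> Y) (G : finGroupType)
    (mu : Y -> Sigma -> G) : computable k F ->
  computable k.+1 (fun h => (F h,
    run (fun h s => mu (F h) s : group_sg G) h)).
Proof.
move=> [V [lam [B [beta [out [sV aB FE]]]]]].
pose o' (p : option (wreath B V)) := out (omap snd p) (omap (@first_of B V) p).
pose lam1 s : wreath B V := ([ffun x => beta x s], lam s).
pose lam2 s : wreath (group_sg G) (wreath B V) :=
  ([ffun x => mu (o' x) s : group_sg G], lam1 s).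
exists (wreath (group_sg G) (wreath B V)), lam2, bool_sg, (fun _ _ => true).
exists (fun v _ => (o' (omap snd v), omap (@first_of _ _) v)).
split; [ | |move=> h]; last 1 first.
- have [-> ->] := run_cascade (fun _ => lam1)
    (fun _ x s => mu (o' x) s : group_sg G) h.
  have FE1 h' : F h' = o' (run (fun _ => lam1) h').
    rewrite /o' FE.
    by have [-> ->] := run_cascade (fun _ => lam) (fun _ => beta) h'.
  by rewrite FE1; congr pair; apply: eq_run => h' s; rewrite FE1.
- by exists G, (wreath B V); split => //; apply: kr_product_stem.
- exact: aperiodic_bool.
Qed.

End Runs.

Lemma run_cat (Sigma : Type) (S : finSemigroup) (lam : Sigma -> S)
    (h1 h2 : seq Sigma) a b :
  run (fun _ => lam) h1 = Some a -> run (fun _ => lam) h2 = Some b ->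
  run (fun _ => lam) (h2 ++ h1) = Some (a ** b).
Proof.
move=> ha; elim: h2 b => //= s h IH b.
case: h IH => [_ [<-]|s' h]; first by rewrite /= ha.
have [c ->] := run_neq0 (fun _ => lam) s' h.
by move=> /(_ _ erefl) /= -> [<-] /=; rewrite sg_mulA.
Qed.

(** The letters, one for each element of [A], generate a subsemigroup of the wreath
   product, on which the output is a homomorphism: a state determines the product of
   the word that led to it. *)
Lemma kr_bound_computable (S : finSemigroup) (A : {set S}) k (x0 : S) :
  subsemigroup A ->
  computable k (run (fun _ (s : {x : S | x \in A}) => val s)) -> kr_bound A k.
Proof.
move=> cA [V [lam [B [beta [out [sV aB E]]]]]].
pose lam1 s : wreath B V := ([ffun x => beta x s], lam s).
exists (wreath B V); first exact: kr_product_stem.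
pose o' (p : option (wreath B V)) := out (omap snd p) (omap (@first_of B V) p).
have E1 h : run (fun _ (s : {x : S | x \in A}) => val s) h =
    o' (run (fun _ => lam1) h).
  rewrite /o' E.
  by have [-> ->] := run_cascade (fun _ => lam) (fun _ => beta) h.
have inA h a : run (fun _ (s : {x : S | x \in A}) => val s) h = Some a -> a \in A.
  elim: h a => //= s h IH a.
  case: (run _ h) IH => [b /(_ _ erefl) bA|_] /= [<-]; last exact: (valP s).
  by apply: cA => //; apply: (valP s).
pose U : {set wreath B V} :=
  [set u | `[< exists h, run (fun _ => lam1) h = Some u >]]%SET.
have UP u : reflect (exists h, run (fun _ => lam1) h = Some u) (u \in U).
  by rewrite /U finset.in_set; apply: asboolP.
pose phi u := odflt x0 (o' (Some u)).
exists U, phi; split.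
- by move=> u v /UP[h hu] /UP[h' hv]; apply/UP; exists (h' ++ h); apply: run_cat.
- move=> u v /UP[h hu] /UP[h' hv]; rewrite /phi -(run_cat hu hv) -hu -hv -!E1.
  case: h hu => // s h _; case: h' hv => // s' h' _.
  have [a ha] := run_neq0 (fun _ (s : {x : S | x \in A}) => val s) s h.
  have [b hb] := run_neq0 (fun _ (s : {x : S | x \in A}) => val s) s' h'.
  by rewrite (run_cat ha hb) ha hb.
apply/setP => a; apply/imsetP/idP => [[u /UP[h hu] ->]|aA].
  rewrite /phi -hu -E1; case: h hu => // s h _.
  have [b hb] := run_neq0 (fun _ (s : {x : S | x \in A}) => val s) s h.
  by rewrite hb /=; apply: inA hb.
exists (lam1 (exist _ a aA)); first by apply/UP; exists [:: exist _ a aA].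
by rewrite /phi -(E1 [:: exist _ a aA]).
Qed.

Lemma kr_bound_sub (S : finSemigroup) (A C : {set S}) k :
  kr_bound A k -> C \subset A -> subsemigroup C -> kr_bound C k.
Proof.
move=> [W kW [U [phi [cU phiM UA]]]] CA cC; exists W => //.
exists (U :&: phi @^-1: C), phi; split.
- move=> u v; rewrite !finset.in_setI !finset.in_set => /andP[uU uC] /andP[vU vC].
  by rewrite cU // phiM //; apply: cC.
- by move=> u v; rewrite !finset.in_setI => /andP[uU _] /andP[vU _]; apply: phiM.
apply/setP => a; apply/imsetP/idP => [[u + ->]|aC].
  by rewrite !finset.in_setI !finset.in_set => /andP[].
have := fintype.subsetP CA _ aC; rewrite -UA => /imsetP[u uU au].
by exists u => //; rewrite finset.in_setI uU finset.in_set -au.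
Qed.

(** * Stabilisers in iterated wreath products *)

Section Lifting.
Variables (T S : finSemigroup) (U : {set T}) (phi : T -> S).
Hypothesis cU : subsemigroup U.
Hypothesis phiM : {in U &, {morph phi : x y / x ** y}}.

Lemma morph_spow (R : finSemigroup) (f : T -> R) x n :
  {in U &, {morph f : x y / x ** y}} ->
  x \in U -> f (spow x n) = spow (f x) n.
Proof.
by move=> fM xU; elim: n => //= n IH; rewrite fM ?IH //; apply: spow_closed.
Qed.

(** A high power of a preimage of [rho] acts in [A] as an idempotent [a], while the
   exponent can be chosen such that it is still a preimage of [rho]. A preimage of
   [eps'] that ends with this power acts as an element fixed by [a] from the right,
   and so do its powers. The maps [Psi y] are treated at once, as they will be the
   values of one function at several points. *)
Lemma aperiodic_lift (A : finSemigroup) (Y : Type) (Psi : Y -> T -> A)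
    (rho eps eps' : S) p :
  aperiodic A ->
  (forall y, {in U &, {morph Psi y : x y / x ** y}}) ->
  spow rho p = eps -> eps ** eps = eps -> eps ** rho = rho ->
  eps' ** eps' = eps' -> eps' ** eps = eps' ->
  rho \in phi @: U -> eps' \in phi @: U ->
  exists u1 u2, [/\ u1 \in U, u2 \in U, phi u1 = rho, phi u2 = eps' &
    forall y, Psi y u2 ** Psi y u1 = Psi y u2 /\ Psi y u2 ** Psi y u2 = Psi y u2].
Proof.
move=> aA PsiM rp ee er ee' e'e /imsetP[u uU ru] /imsetP[w wU ew].
have [n nP] := aperiodic_power aA.
have stable (a : A) j : spow a (n + j) = spow a n.
  elim: j => [|j IH]; first by rewrite addn0.
  by rewrite addnS /= IH; have [_] := nP a.
pose q := n * p.+1 + p.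
have qn : q = n + (n * p + p) by rewrite /q; lia.
have rq : spow rho q = eps by rewrite /q -spowM rp spow_idem.
pose v := w ** spow u q.
have vU : v \in U by apply: cU => //; apply: spow_closed.
have phiv : phi v = eps' by rewrite phiM ?spow_closed // morph_spow // -ew -ru rq.
exists (spow u q.+1), (spow v n); split; try exact: spow_closed.
- by rewrite morph_spow // -ru /= rq.
- by rewrite morph_spow // phiv spow_idem.
move=> y; rewrite !morph_spow //; have [-> _] := nP (Psi y v); split => //.
have -> : spow (Psi y u) q.+1 = spow (Psi y u) n by rewrite qn -addnS stable.
have va : Psi y v ** spow (Psi y u) n = Psi y v.
  rewrite PsiM ?spow_closed // morph_spow // qn stable -sg_mulA.
  by have [-> _] := nP (Psi y u).
by case: (n) va => [|k] va //=; rewrite -sg_mulA va.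
Qed.

End Lifting.

(** A chain of idempotents [eps i], each but the last with a group element [rho i]
   above the next one, in which the idempotents of a semigroup containing [rho i] and
   [eps i.+1] produce the next pair. Products of fewer than [L] groups are shown
   to be too small for such a chain. *)
Section LowerBound.
Variables (S : finSemigroup) (L : nat) (rho eps : nat -> S) (p : nat -> nat).
Hypothesis rhoX : forall i, i < L -> spow (rho i) (p i) = eps i.
Hypothesis eps_idem : forall i, i <= L -> eps i ** eps i = eps i.
Hypothesis eps_rho : forall i, i < L -> eps i ** rho i = rho i.
Hypothesis eps_lt : forall i, i < L ->
  eps i ** eps i.+1 = eps i.+1 /\ eps i.+1 ** eps i = eps i.+1.
Hypothesis eps_rho_neq : forall i, i < L -> eps i.+1 ** rho i != eps i.+1.
Hypothesis descend : forall i (Q D : {set S}), i.+1 < L ->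
  subsemigroup Q -> subsemigroup D ->
  (forall a, a \in Q -> a ** a = a -> a \in D) ->
  rho i \in Q -> eps i.+1 \in Q -> rho i.+1 \in D /\ eps i.+2 \in D.

(** The state [psi x] is fixed by preimages of [rho m] and [eps m.+1]. In the
   induction step let [x] fix the state of [W] only. On the elements that fix it,
   the group component at the points below [x] is a homomorphism; its kernel [K]
   contains all idempotents, so it covers the next pair by [descend], and it fixes
   the state of [x] in the wreath product of [G] and [W]. On [K] the component in [A]
   is again a homomorphism, and [aperiodic_lift] applies. *)
Lemma kr_product_stabiliser m W : kr_product m W -> m < L ->
  forall (T : finSemigroup) (U : {set T}) (phi : T -> S) (psi : T -> W),
  subsemigroup U -> {in U &, {morph phi : x y / x ** y}} ->
  {in U &, {morph psi : x y / x ** y}} ->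
  rho 0 \in phi @: U -> eps 1 \in phi @: U ->
  exists x, [/\ x \in U, phi x = eps m.+1 &
    let D := [set u in U | psi x ** psi u == psi x] in
    rho m \in phi @: D /\ eps m.+1 \in phi @: D].
Proof.
elim=> {m W} [A aA L0 T U phi psi cU phiM psiM r0 e1|].
  have [e01 e10] := eps_lt L0.
  have [u1 [u2 [u1U u2U r e uP]]] := aperiodic_lift cU phiM aA
    (fun _ : unit => psiM) (rhoX L0) (eps_idem (ltnW L0)) (eps_rho L0)
    (eps_idem L0) e10 r0 e1.
  have [u21 u22] := uP tt.
  exists u2; split => //=; split; apply/imsetP; [exists u1|exists u2] => //.
  - by rewrite finset.in_set u1U; apply/eqP.
  - by rewrite finset.in_set u2U; apply/eqP.
move=> m W A G kW IH aA Lm T U phi psi cU phiM psiM r0 e1.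
have psi2M : {in U &, {morph (fun u => (psi u).2.2) : x y / x ** y}}.
  by move=> u v uU vU; rewrite psiM.
have [x [xU phix [/= rD eD]]] := IH (ltnW Lm) T U phi _ cU phiM psi2M r0 e1.
set D := [set u in U | _] in rD eD.
have DP u : reflect (u \in U /\ (psi x).2.2 ** (psi u).2.2 = (psi x).2.2) (u \in D).
  by rewrite finset.in_set; apply: (iffP andP) => -[uU /eqP].
have fixW u (y : option W) : u \in D ->
    actI (actI y (psi x).2.2) (psi u).2.2 = actI y (psi x).2.2.
  by move=> /DP[_ fu]; case: y => [y|] /=; rewrite -?sg_mulA fu.
have cD : subsemigroup D.
  move=> u v /DP[uU fu] /DP[vU fv]; apply/DP; split; first exact: cU.
  by rewrite psi2M // sg_mulA fu fv.
(* [actI y (psi x).2.2] runs through the states below [x] *)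
pose K : {set T} :=
  [set u in D | [forall y, (psi u).2.1 (actI y (psi x).2.2) == 1%g]]%SET.
have KP u : reflect (u \in D /\ forall y, (psi u).2.1 (actI y (psi x).2.2) = 1%g)
    (u \in K).
  rewrite [X in reflect _ X]finset.in_set; apply: (iffP idP).
    by move=> /andP[uD /forallP k]; split => // y; apply/eqP.
  by move=> [uD k]; apply/andP; split => //; apply/forallP => y; apply/eqP.
have DU u : u \in D -> u \in U by case/DP.
have KD u : u \in K -> u \in D by case/KP.
have prodG u v y : u \in D -> v \in D ->
    (psi (u ** v)).2.1 (actI y (psi x).2.2) =
    ((psi u).2.1 (actI y (psi x).2.2) * (psi v).2.1 (actI y (psi x).2.2))%g.
  by move=> uD vD; rewrite psiM ?DU //= ffunE fixW.
have cK : subsemigroup K.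
  move=> u v /KP[uD ku] /KP[vD kv]; apply/KP; split; first exact: cD.
  by move=> y; rewrite prodG // ku kv mulg1.
have phiMD : {in D &, {morph phi : x y / x ** y}}.
  by move=> u v uD vD; apply: phiM; apply: DU.
have phiMK : {in K &, {morph phi : x y / x ** y}}.
  by move=> u v uD vD; apply: phiMD; apply: KD.
have [rK eK] : rho m.+1 \in phi @: K /\ eps m.+2 \in phi @: K.
  apply: (descend (Q := phi @: D)) => //.
  - by move=> _ _ /imsetP[u uD ->] /imsetP[v vD ->]; rewrite -phiMD //; apply/imset_f/cD.
  - by move=> _ _ /imsetP[u uD ->] /imsetP[v vD ->]; rewrite -phiMK //; apply/imset_f/cK.
  move=> _ /imsetP[u uD ->] idu; have [n nP] := idempotent_power u.
  apply/imsetP; exists (spow u n); last by rewrite (morph_spow cD) // spow_idem.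
  have uXD : spow u n \in D by apply: spow_closed.
  apply/KP; split => // y; have := prodG _ _ y uXD uXD.
  by rewrite nP => e; apply: (mulgI ((psi (spow u n)).2.1 (actI y (psi x).2.2))); rewrite mulg1 -e.
have fixV u : u \in K -> (psi x).2 ** (psi u).2 = (psi x).2.
  move=> uK; have /DP[_ fu] := KD _ uK; have /KP[_ ku] := uK.
  rewrite [RHS]surjective_pairing; congr pair => //=.
  by apply/ffunP => y; rewrite ffunE ku; apply: mulg1.
have fixVI u (y : option (wreath (group_sg G) W)) : u \in K ->
    actI (actI y (psi x).2) (psi u).2 = actI y (psi x).2.
  by move=> uK; case: y => [y|]; rewrite /actI -?sg_mulA fixV.
pose Psi (y : option (wreath (group_sg G) W)) u := (psi u).1 (actI y (psi x).2).
have PsiM y : {in K &, {morph Psi y : x y / x ** y}}.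
  move=> u v uK vK; rewrite /Psi psiM ?DU ?KD //.
  by rewrite [LHS]ffunE fixVI.
(* [u1] and [u2] need not fix [psi x] in the factor [A], but they fix [psi (x ** u2)] *)
have [e12 e21] := eps_lt Lm.
have [u1 [u2 [u1K u2K phi1 phi2 uP]]] := aperiodic_lift cK phiMK aA
  PsiM (rhoX Lm) (eps_idem (ltnW Lm)) (eps_rho Lm) (eps_idem Lm) e21 rK eK.
have u1U := DU _ (KD _ u1K); have u2U := DU _ (KD _ u2K).
have fixA u : u \in K -> (forall y, Psi y u2 ** Psi y u = Psi y u2) ->
    psi (x ** u2) ** psi u = psi (x ** u2).
  move=> uK fu; rewrite psiM //.
  have E2 : (psi x ** psi u2 ** psi u).2 = (psi x ** psi u2).2.
    rewrite -[LHS]/((psi x).2 ** (psi u2).2 ** (psi u).2).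
    by rewrite -[RHS]/((psi x).2 ** (psi u2).2) fixV // fixV.
  have E1 : (psi x ** psi u2 ** psi u).1 = (psi x ** psi u2).1.
    apply/ffunP => y; rewrite -[LHS]/([ffun z => _] y) -[RHS]/([ffun z => _] y).
    rewrite [LHS]ffunE [RHS]ffunE [X in X ** _]ffunE -sg_mulA; congr (_ ** _).
    rewrite -[LHS]/(Psi y u2 ** (psi u).1 (actI y ((psi x).2 ** (psi u2).2))).
    by rewrite fixV // fu.
  by rewrite [LHS]surjective_pairing E1 E2 -surjective_pairing.
exists (x ** u2); split; first exact: cU.
  by rewrite phiM // phix phi2.
split; apply/imsetP; [exists u1|exists u2] => //; rewrite finset.in_set.
- by rewrite u1U; apply/eqP/fixA => // y; have [] := uP y.
- by rewrite u2U; apply/eqP/fixA => // y; have [] := uP y.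
Qed.

(** If [x] is fixed by a preimage of [rho k], then so is its image [eps k.+1], which
   contradicts [eps_rho_neq]. *)
Lemma kr_bound_lower (A : {set S}) k :
  rho 0 \in A -> eps 1 \in A -> kr_bound A k -> L <= k.
Proof.
move=> r0 e1 [W kW [U [phi [cU phiM UA]]]]; rewrite leqNgt; apply/negP => kL.
rewrite -UA in r0 e1.
have [x [xU phix [/= /imsetP[u uD ru] _]]] := kr_product_stabiliser kW kL cU phiM
  (psi := id) (fun _ _ _ _ => erefl) r0 e1.
move: uD; rewrite finset.in_set => /andP[uU /eqP xu].
by have /eqP[] := eps_rho_neq kL; rewrite ru -phix -phiM // xu.
Qed.

End LowerBound.

(** * Partitions and their colourings *)

Section Colourings.
Variable n : nat.
Implicit Types (p q : partition_sg n) (c d e : 'I_n -> bool) (x y z : vertex n) (a b u v : vertex3 n).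

Lemma ptn_refl p x : (x, x) \in val p.
Proof. by have /equivalencebP[r _ _] := valP p. Qed.

Lemma ptn_sym p x y : (x, y) \in val p -> (y, x) \in val p.
Proof. by have /equivalencebP[_ s _] := valP p; apply: s. Qed.

Lemma ptn_trans p x y z :
  (x, y) \in val p -> (y, z) \in val p -> (x, z) \in val p.
Proof. by have /equivalencebP[_ _ t] := valP p; apply: t. Qed.

Definition vcol c d x : bool := match x with inl k => c k | inr k => d k end.

(** A partition is known from its two-coloured colourings, and under this reading
   the product of partitions is the composition of relations: a colouring of the
   outer vertices extends to the middle ones, because each generated class can be
   given the colour of its outer vertices. *)
Definition colours p c d : Prop :=
  forall x y, (x, y) \in val p -> vcol c d x = vcol c d y.

Lemma colours_ext p q : (forall c d, colours p c d <-> colours q c d) -> p = q.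
Proof.
suff sub (a b : partition_sg n) : (forall c d, colours b c d -> colours a c d) ->
    val a \subset val b.
  move=> E; apply/val_inj/eqP; rewrite finset.eqEsubset.
  by rewrite !sub // => c d /E.
move=> E; apply/fintype.subsetP => -[x y] xy.
pose C z := (x, z) \in val b.
have CE z : vcol (C \o inl) (C \o inr) z = C z by case: z.
have /E/(_ x y xy) : colours b (C \o inl) (C \o inr).
  move=> u v uv; rewrite !CE; apply/idP/idP => xu; apply: ptn_trans xu _ => //.
  exact: ptn_sym.
by rewrite !CE /C ptn_refl => <-.
Qed.

Definition edges p q : {set vertex3 n * vertex3 n} := Defs.glue (val p) (val q).

Definition linked p q : rel (vertex3 n) := Defs.generated (edges p q).

Lemma edges_sym p q a b :
  (a, b) \in edges p q -> (b, a) \in edges p q.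
Proof.
by rewrite !finset.in_setU => /orP[] /push_sym -> //; rewrite ?(valP p, valP q, orbT).
Qed.

Lemma linked_sym p q a b :
  linked p q a b = linked p q b a.
Proof.
by apply: sym_connect_sym => u v; apply/idP/idP; apply: edges_sym.
Qed.

Lemma linked_refl p q a : linked p q a a.
Proof. exact: connect0. Qed.

Lemma linked_trans p q a b u :
  linked p q a b -> linked p q b u -> linked p q a u.
Proof. exact: connect_trans. Qed.

Lemma linked_upper p q x y : (x, y) \in val p ->
  linked p q (upper x) (upper y).
Proof.
by move=> xy; apply: connect1; rewrite finset.in_setU push_in.
Qed.

Lemma linked_lower p q x y : (x, y) \in val q ->
  linked p q (lower x) (lower y).
Proof.
by move=> xy; apply: connect1; rewrite finset.in_setU push_in ?orbT.
Qed.

Lemma ptn_mulE p q x y : ((x, y) \in val (p ** q)) =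
  linked p q (outer x) (outer y).
Proof. by rewrite [LHS]finset.in_set. Qed.

Lemma colours_mul p q c e :
  colours (p ** q) c e <-> exists d, colours p c d /\ colours q d e.
Proof.
split=> [ce|[d [cd de]] x y].
  pose D v := [exists x, vcol c e x && linked p q (outer x) v].
  have Dgen u v : linked p q u v -> D u = D v.
    move=> uv; apply/existsP/existsP => -[x /andP[cx xu]]; exists x.
      by rewrite cx; apply: linked_trans uv.
    by rewrite cx; apply: linked_trans xu _; rewrite linked_sym.
  have Dout x : D (outer x) = vcol c e x.
    apply/existsP/idP => [[y /andP[cy yx]]|cx].
      by rewrite -(ce y x) // ptn_mulE.
    by exists x; rewrite cx; apply: linked_refl.
  exists (fun k => D (inl (inr k))).
  have up x : vcol c (fun k => D (inl (inr k))) x = D (upper x).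
    by case: x => k //; apply/esym/(Dout (inl k)).
  have lo x : vcol (fun k => D (inl (inr k))) e x = D (lower x).
    by case: x => k //; apply/esym/(Dout (inr k)).
  split=> x y xy.
    by rewrite !up; apply/Dgen/linked_upper.
  by rewrite !lo; apply/Dgen/linked_lower.
rewrite ptn_mulE.
pose D (v : vertex3 n) := match v with
  | inl (inl k) => c k | inl (inr k) => d k | inr k => e k end.
have Dout z : D (outer z) = vcol c e z by case: z.
rewrite -!Dout; move: (outer x) (outer y).
apply: generated_min => // u v w -> .
rewrite finset.in_setU => /orP[] /imsetP[[a b] ab [-> ->]].
  by have := cd _ _ ab; case: (a) => k; case: (b) => l.
by have := de _ _ ab; case: (a) => k; case: (b) => l.
Qed.

Lemma kernel_equiv (K : eqType) (f : vertex n -> K) :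
  equivalenceb [set xy : vertex n * vertex n | f xy.1 == f xy.2]%SET.
Proof.
apply/equivalencebP; split => [x|x y|x y z]; rewrite !finset.in_set //=.
  by rewrite eq_sym.
by move=> /eqP -> /eqP ->.
Qed.

Definition kernel (K : eqType) (f : vertex n -> K) : partition_sg n :=
  Sub _ (kernel_equiv f).

Lemma in_kernel (K : eqType) (f : vertex n -> K) x y :
  ((x, y) \in val (kernel f)) = (f x == f y).
Proof. by rewrite SubK finset.in_set. Qed.

Definition drop_label (D : {set 'I_n}) x : nat * 'I_n :=
  match x with
  | inl k => (if k \in D then 1 else 0, k)
  | inr k => (if k \in D then 2 else 0, k)
  end.

(** The identity on the points outside [D]; the points of [D] are singletons on both
   sides. *)
Definition dropp D := kernel (drop_label D).

Lemma colours_drop D c d : colours (dropp D) c d <-> (forall k, k \notin D -> c k = d k).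
Proof.
split=> [cd k kD|cd x y].
  by apply: (cd (inl k) (inr k)); rewrite in_kernel /= (negbTE kD).
rewrite in_kernel => /eqP; case: x y => [k|k] [l|l] /= [E kl]; subst l => //.
  by apply: cd; apply/negP => kD; rewrite kD in E.
by apply/esym/cd; apply/negP => kD; rewrite kD in E.
Qed.

Definition perm_label (g : 'S_n) x : 'I_n :=
  match x with inl k => g k | inr k => k end.

Definition permp g := kernel (perm_label g).

Lemma colours_perm g c d : colours (permp g) c d <-> (forall k, c k = d (g k)).
Proof.
split=> [cd k|cd x y].
  by apply: (cd (inl k) (inr (g k))); rewrite in_kernel.
rewrite in_kernel => /eqP; case: x y => [k|k] [l|l] /=.
- by move=> /perm_inj ->.
- by move=> <-.
- by move=> ->.
- by move=> ->.
Qed.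

Definition flip x : vertex n := match x with inl k => inr k | inr k => inl k end.

Lemma star_equiv p :
  equivalenceb [set xy : vertex n * vertex n | (flip xy.1, flip xy.2) \in val p]%SET.
Proof.
apply/equivalencebP; split => [x|x y|x y z]; rewrite !finset.in_set /=.
- exact: ptn_refl.
- exact: ptn_sym.
- exact: ptn_trans.
Qed.

Definition star p : partition_sg n := Sub _ (star_equiv p).

Lemma in_star p x y : ((x, y) \in val (star p)) = ((flip x, flip y) \in val p).
Proof. by rewrite SubK finset.in_set. Qed.

Lemma colours_star p c d : colours (star p) c d <-> colours p d c.
Proof.
split=> cd x y xy.
  have := cd (flip x) (flip y); rewrite in_star.
  by case: x y xy => k [] l /= xy; apply.
have := cd (flip x) (flip y); rewrite -in_star.
by case: x y xy => k [] l /= xy; apply.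
Qed.

Lemma dropp0 : dropp finset.set0 = permp 1%g.
Proof.
apply: colours_ext => c d; rewrite colours_drop colours_perm.
by split=> cd k; [rewrite perm1; apply: cd; rewrite finset.in_set0|rewrite cd perm1].
Qed.

Lemma mul_dropp0 p : dropp finset.set0 ** p = p.
Proof.
apply: colours_ext => c e; rewrite colours_mul; split=> [[d [/colours_drop cd]]|ce].
  have -> // : c = d by apply/funext => k; apply: cd; rewrite finset.in_set0.
by exists c; split => //; apply/colours_drop.
Qed.

Lemma mulr_dropp0 p : p ** dropp finset.set0 = p.
Proof.
apply: colours_ext => c e; rewrite colours_mul; split=> [[d [cd /colours_drop de]]|ce].
  have <- // : d = e by apply/funext => k; apply: de; rewrite finset.in_set0.
by exists e; split => //; apply/colours_drop.
Qed.

Lemma dropp_mul D E : dropp D ** dropp E = dropp (D :|: E)%SET.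
Proof.
apply: colours_ext => c e; rewrite colours_mul colours_drop; split=> [[d []]|ce].
  move=> /colours_drop cd /colours_drop de k; rewrite finset.in_setU negb_or.
  by move=> /andP[kD kE]; rewrite cd // de.
exists (fun k => if k \in D then e k else c k); split; apply/colours_drop => k kD.
  by rewrite (negbTE kD).
by case: ifP => // kE; apply: ce; rewrite finset.in_setU kE.
Qed.

Lemma dropp_idem D : dropp D ** dropp D = dropp D.
Proof. by rewrite dropp_mul finset.setUid. Qed.

Lemma permp_mul g g' : permp g ** permp g' = permp (g * g')%g.
Proof.
apply: colours_ext => c e; rewrite colours_mul colours_perm; split=> [[d []]|ce].
  by move=> /colours_perm cd /colours_perm de k; rewrite cd de permM.
exists (e \o g'); split; apply/colours_perm => k //=.
by rewrite ce permM.
Qed.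

Lemma permp_drop g D :
  permp g ** dropp D = dropp [set k | g k \in D]%SET ** permp g.
Proof.
apply: colours_ext => c e; rewrite !colours_mul; split=> [] [d []].
  move=> /colours_perm cd /colours_drop de; exists (e \o g).
  split; last exact/colours_perm.
  by apply/colours_drop => k; rewrite finset.in_set => kD; rewrite cd de.
move=> /colours_drop cd /colours_perm de; exists (c \o (g^-1)%g).
split; first by apply/colours_perm => k /=; rewrite permK.
apply/colours_drop => k kD /=; rewrite cd ?finset.in_set ?permKV //.
by rewrite de permKV.
Qed.

(** A block of [p] that stays on the top side is destroyed when the points outside
   [A] are cut, but the copy of it on the top side of the left factor [p] remains. *)
Lemma star_drop p (A : {set 'I_n}) :
  (forall i j : 'I_n, (inl i, inr j) \in val p -> i \in A) ->
  p ** star p ** dropp (~: A)%SET ** p = p.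
Proof.
move=> pA; apply: colours_ext => c d; rewrite colours_mul; split=> [[d2 []]|cd].
  rewrite colours_mul => -[d1 []]; rewrite colours_mul => -[e [ce /colours_star de]].
  move=> /colours_drop d12 dd.
  have cross (i j : 'I_n) : (inl i, inr j) \in val p -> c i = d j.
    move=> ij; have /= -> := ce _ _ ij; have /= <- := dd _ _ ij.
    have /= <- := de _ _ ij; apply: d12.
    by rewrite finset.in_setC negbK; apply: pA ij.
  move=> [a|a] [b|b] ab.
  - exact: (ce _ _ ab).
  - exact: cross.
  - exact/esym/cross/ptn_sym.
  - exact: (dd _ _ ab).
exists c; split => //; rewrite colours_mul; exists c; split; last exact/colours_drop.
by rewrite colours_mul; exists d; split => //; apply/colours_star.
Qed.

End Colourings.

(** * Products of partial matchings *)

Section Brauer.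
Variable n : nat.
Implicit Types (p q : partition_sg n) (x y z : vertex n) (u v w : vertex3 n).

(** A partition is seen as the graph whose edges join the distinct points of a
   block. *)
Definition degree_le1 p := forall x y z,
  (x, y) \in val p -> (x, z) \in val p -> x != y -> x != z -> y = z.

Definition degree_ge1 p := forall x, exists2 y, x != y & (x, y) \in val p.

Lemma blocksP p (B : {set vertex n}) :
  reflect (exists x, B = [set y | (x, y) \in val p]%SET) (B \in blocks p).
Proof.
apply: (iffP imsetP) => [[x _ ->]|[x ->]]; exists x => //.
  by apply/setP => y; rewrite !finset.in_set.
by apply/setP => y; rewrite !finset.in_set.
Qed.

Lemma partial_brauerP p : reflect (degree_le1 p) (p \in partial_brauer n).
Proof.
rewrite finset.in_set; apply: (iffP idP) => [/forallP le2 x y z xy xz nxy nxz|d1].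
  apply/eqP; apply: contraT => nyz.
  have /implyP := le2 [set y | (x, y) \in val p]%SET.
  have -> : [set y | (x, y) \in val p]%SET \in blocks p by apply/blocksP; exists x.
  move=> /(_ isT); rewrite leqNgt => /negP[].
  have <- : #|[set x; y; z]%SET| = 3.
    by rewrite finset.setUC cardsU1 cards2 finset.in_set2 negb_or ![z == _]eq_sym nxy nxz nyz.
  apply/subset_leq_card/fintype.subsetP => t.
  rewrite [in X in _ -> X]finset.in_set.
  by move=> /finset.setUP[/finset.set2P[]|/finset.set1P] -> //; apply: ptn_refl.
apply/forallP => B; apply/implyP => /blocksP[x ->].
have [/existsP[y /andP[nxy xy]]|] := boolP [exists y, (x != y) && ((x, y) \in val p)].
  apply: (@leq_trans #|[set x; y]%SET|); last by rewrite cards2; case: eqP.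
  apply/subset_leq_card/fintype.subsetP => z; rewrite finset.in_set2 finset.in_set.
  have [-> //|nxz xz] := eqVneq z x; rewrite (d1 x y z xy xz) ?eqxx ?orbT //.
  by rewrite eq_sym.
rewrite negb_exists => /forallP none.
apply: (@leq_trans #|[set x]%SET|); last by rewrite cards1.
apply/subset_leq_card/fintype.subsetP => z; rewrite finset.in_set1 finset.in_set => xz.
by have := none z; rewrite xz andbT negbK eq_sym.
Qed.

Lemma brauerP p :
  reflect (degree_le1 p /\ degree_ge1 p) (p \in brauer n).
Proof.
have B2 x : degree_le1 p -> (exists2 y, x != y & (x, y) \in val p) ->
    #|[set y | (x, y) \in val p]%SET| = 2.
  move=> d1 [y nxy xy]; rewrite -[RHS]/((true : nat).+1) -nxy -cards2; apply: eq_card => z.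
  rewrite finset.in_set2 finset.in_set; apply/idP/idP => [xz|/orP[]/eqP-> //].
    have [//|nxz] := eqVneq z x; apply/eqP.
    by apply: d1 xz xy _ nxy; rewrite eq_sym.
  exact: ptn_refl.
rewrite finset.in_set; apply: (iffP forallP) => [eq2|[d1 d2] B].
  have pb : degree_le1 p.
    apply/partial_brauerP; rewrite finset.in_set; apply/forallP => B.
    by apply/implyP => Bp; have /implyP/(_ Bp)/eqP -> := eq2 B.
  split=> // x; have /implyP := eq2 [set y | (x, y) \in val p]%SET.
  have -> : [set y | (x, y) \in val p]%SET \in blocks p by apply/blocksP; exists x.
  move=> /(_ isT)/eqP c2.
  have /card_gt0P[y] : 0 < #|[set y | (x, y) \in val p]%SET :\ x|.
    have xx : x \in [set y | (x, y) \in val p]%SET by rewrite finset.in_set ptn_refl.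
    by rewrite (cardsD1 x) xx in c2; case: c2; rewrite add0n => ->.
  by rewrite finset.in_setD1 finset.in_set eq_sym => /andP[nxy xy]; exists y.
by apply/implyP => /blocksP[x ->]; rewrite B2.
Qed.

Definition mate p x : option (vertex n) :=
  [pick y | (x != y) && ((x, y) \in val p)].

Lemma mateP p x y : degree_le1 p ->
  mate p x = Some y <-> x != y /\ (x, y) \in val p.
Proof.
move=> d1; rewrite /mate; case: pickP => [z /andP[nxz xz]|none]; split=> //.
- by case=> <-.
- by case=> nxy xy; rewrite (d1 x y z).
- by case=> nxy xy; have := none y; rewrite nxy xy.
Qed.

Lemma mate_sym p x y : degree_le1 p -> mate p x = Some y -> mate p y = Some x.
Proof.
move=> d1 /(mateP _ _ d1)[nxy xy]; apply/mateP => //.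
by rewrite eq_sym; split => //; apply: ptn_sym.
Qed.

Definition unlower v : option (vertex n) :=
  match v with
  | inl (inl _) => None | inl (inr k) => Some (inl k) | inr k => Some (inr k)
  end.

Lemma unlowerK x : unlower (lower x) = Some x.
Proof. by case: x. Qed.

Lemma unlower_eq v x : unlower v = Some x -> v = lower x.
Proof. by case: v => [[k|k]|k] //= [<-]. Qed.

Section Trail.
Variables p q : partition_sg n.
Hypotheses (dp : degree_le1 p) (dq : degree_le1 q).

(** A vertex of the glued graph has at most one neighbour in either layer, so the
   component of an outer vertex is a path that uses the two layers alternately. It is
   walked along deterministically; the flag tells which layer comes next, [true]
   standing for the upper one. *)
Definition trail_step (s : vertex3 n * bool) : option (vertex3 n * bool) :=
  if s.2 then
    if s.1 is inl x then omap (fun y => (upper y, false)) (mate p x) else None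
  else obind (fun x => omap (fun y => (lower y, true)) (mate q x)) (unlower s.1).

Definition trail x k : option (vertex3 n * bool) :=
  iter k (obind trail_step) (Some (outer x, if x is inl _ then true else false)).

Variant trail_step_spec (s t : vertex3 n * bool) : Prop :=
| StepUpper x y of s = (upper x, true) & mate p x = Some y & t = (upper y, false)
| StepLower x y of s = (lower x, false) & mate q x = Some y & t = (lower y, true).

Lemma trail_stepP s t : trail_step s = Some t -> trail_step_spec s t.
Proof.
case: s => v [] /=; rewrite /trail_step /=.
  case: v => // x; case E: (mate p x) => [y|] //= [<-].
  exact: StepUpper erefl E erefl.
case E: (unlower v) => [x|] //=; case E': (mate q x) => [y|] //= [<-].
by apply: StepLower E' erefl; rewrite (unlower_eq E).
Qed.

Lemma trail_step_upper x y : mate p x = Some y ->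
  trail_step (upper x, true) = Some (upper y, false).
Proof. by rewrite /trail_step /= => ->. Qed.

Lemma trail_step_lower x y : mate q x = Some y ->
  trail_step (lower x, false) = Some (lower y, true).
Proof. by rewrite /trail_step /= unlowerK /= => ->. Qed.

Lemma trailS x k : trail x k.+1 = obind trail_step (trail x k).
Proof. by []. Qed.

Lemma trailSP x k t : trail x k.+1 = Some t ->
  exists2 s, trail x k = Some s & trail_step_spec s t.
Proof.
rewrite trailS; case: (trail x k) => [s|] //= /trail_stepP st.
by exists s.
Qed.

Lemma trail_linked x k s : trail x k = Some s -> linked p q (outer x) s.1.
Proof.
elim: k s => [|k IH] s; first by case=> <-; apply: linked_refl.
move=> /trailSP[t /IH xt [a b te + ->|a b te + ->]]; rewrite {}te /= in xt.
- by move=> /(mateP _ _ dp)[_ ab]; apply: linked_trans xt _; apply: linked_upper.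
- by move=> /(mateP _ _ dq)[_ ab]; apply: linked_trans xt _; apply: linked_lower.
Qed.

Lemma lower_inj : injective (@lower n).
Proof. by move=> x y E; apply: Some_inj; rewrite -!unlowerK E. Qed.
Lemma outer_inj : injective (@outer n). Proof. by move=> [k|k] [l|l] // [->]. Qed.

(** The vertices on the trail are closed under edges: one of the two neighbours of
   such a vertex comes next on the trail, and the other one came before. *)
Lemma trail_complete x v : linked p q (outer x) v ->
  exists k b, trail x k = Some (v, b).
Proof.
suff: forall u, linked p q u v -> u = outer x -> exists k b, trail x k = Some (v, b).
  by move=> E /E; apply.
move=> u uv; move: u v uv; apply: generated_min => [u ->|u v w IH vw ux].
  by exists 0, (if x is inl _ then true else false).
have {IH} [k [b kv]] := IH ux.
have go c t : trail x k = Some (v, c) -> trail_step (v, c) = Some (w, t) ->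
    exists k b, trail x k = Some (w, b).
  by move=> E st; exists k.+1, t; rewrite trailS E.
move: vw; rewrite finset.in_setU => /orP[] /imsetP[[a c] ac [va wc]]; subst v w;
  have [<-|nac] := eqVneq a c; try by exists k, b.
- have mac : mate p a = Some c by apply/mateP.
  case: b kv => kv; first by apply: go kv _; apply: trail_step_upper.
  case: k kv {go} => [[ ]|k]; first by case: x {ux}.
  move=> /trailSP[s sk [y z sE yz [za]|//]].
  have [yc] : Some y = Some c by rewrite -mac za; apply/esym/mate_sym.
  by exists k, true; rewrite sk sE yc.
- have mac : mate q a = Some c by apply/mateP.
  case: b kv => kv; last by apply: go kv _; apply: trail_step_lower.
  case: k kv {go} => [[ ]|k]; first by case: x {ux} => // l; case: (a).
  move=> /trailSP[s sk [//|y z sE yz [/lower_inj za]]].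
  have [yc] : Some y = Some c by rewrite -mac za; apply/esym/mate_sym.
  by exists k, false; rewrite sk sE yc.
Qed.

(** An outer vertex lies in one layer only, through which the trail has just come. *)
Lemma trail_stop x k y b : trail x k.+1 = Some (outer y, b) -> trail x k.+2 = None.
Proof.
move=> E; rewrite trailS E /=.
by have [s _ [a c _ _ [yc ->]|a c _ _ [yc ->]]] := trailSP E;
  case: y c yc {E} => j [].
Qed.

Lemma trail_none x k l : trail x k = None -> k <= l -> trail x l = None.
Proof. by move=> E /subnKC <-; elim: (l - k) => [|j IH]; rewrite ?addn0 // addnS trailS IH. Qed.

Lemma trail_outer_eq x k l y z b c : trail x k.+1 = Some (outer y, b) ->
  trail x l.+1 = Some (outer z, c) -> y = z.
Proof.
wlog kl : k l y z b c / k <= l.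
  move=> wl E E'; have [kl|lk] := leqP k l; first exact: wl E E'.
  by apply/esym; apply: wl (ltnW lk) E' E.
move=> E E'; move: kl; rewrite leq_eqVlt => /orP[/eqP kl|kl].
  by apply: outer_inj; move: E; rewrite kl E' => -[->].
by have := trail_none (trail_stop E) (l := l.+1) kl; rewrite E'.
Qed.

Lemma trail_outer x y : x != y -> linked p q (outer x) (outer y) ->
  exists k b, trail x k.+1 = Some (outer y, b).
Proof.
move=> nxy /trail_complete[[|k] [b E]]; last by exists k, b.
by move: E => [/outer_inj xy _]; rewrite xy eqxx in nxy.
Qed.

Lemma degree_le1_mul : degree_le1 (p ** q).
Proof.
move=> x y z; rewrite !ptn_mulE => xy xz nxy nxz.
have [k [b E]] := trail_outer nxy xy.
have [l [c E']] := trail_outer nxz xz.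
exact: trail_outer_eq E E'.
Qed.

End Trail.

Lemma involution_even (T : finType) (K : {set T}) (f : T -> T) :
  (forall x : T, x \in K -> [/\ f x \in K, f x != x & f (f x) = x]) -> ~~ odd #|K|.
Proof.
elim: {K}_.+1 {-2}K (ltnSn #|K|) => // m IH K Km fK.
have [->|[x xK]] := set_0Vmem K; first by rewrite cards0.
have [fxK nfx ffx] := fK x xK.
have fxKx : f x \in K :\ x by rewrite finset.in_setD1 nfx.
rewrite (cardsD1 x) xK (cardsD1 (f x)) fxKx /= negbK.
apply: IH => [|y].
  by move: Km; rewrite (cardsD1 x) xK (cardsD1 (f x) (K :\ x)) fxKx; lia.
rewrite !finset.in_setD1 => /and3P[nyfx nyx yK].
have [fyK nfy ffy] := fK y yK; split => //; rewrite fyK andbT; apply/andP; split.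
  by apply: contra nyx => /eqP fyx; rewrite -ffy fyx ffx.
by apply: contra nyfx => /eqP fyx; rewrite -ffy fyx.
Qed.

Lemma degree_ge1_even p (K : {set vertex n}) : degree_le1 p -> degree_ge1 p ->
  (forall x y, (x, y) \in val p -> x \in K -> y \in K) -> ~~ odd #|K|.
Proof.
move=> d1 d2 cK; apply: (@involution_even _ K (fun x => odflt x (mate p x))) => x xK.
have [y nxy xy] := d2 x; have E : mate p x = Some y by apply/mateP.
rewrite E /= (mate_sym d1 E) /= eq_sym; split => //; exact: cK xK.
Qed.

Lemma card_sum_set (A B : finType) (K : {set A + B}) :
  #|K| = #|[set a | inl a \in K]%SET| + #|[set b | inr b \in K]%SET|.
Proof.
rewrite -!sum1_card big_sumType /=; congr addn; apply: eq_bigl => k;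
  by rewrite finset.in_set.
Qed.

(** The class of [x] meets each layer in an even number of vertices, as it is closed
   under the perfect matching of this layer. Counting the middle vertices twice shows
   that it has evenly many outer vertices, so [x] is not the only one. *)
Lemma degree_ge1_mul p q : degree_le1 p -> degree_le1 q ->
  degree_ge1 p -> degree_ge1 q -> degree_ge1 (p ** q).
Proof.
move=> p1 q1 p2 q2 x.
have evenU : ~~ odd #|[set y | linked p q (outer x) (upper y)]%SET|.
  apply: degree_ge1_even p1 p2 _ => a b ab; rewrite !finset.in_set => xa.
  by apply: linked_trans xa _; apply: linked_upper.
have evenL : ~~ odd #|[set y | linked p q (outer x) (lower y)]%SET|.
  apply: degree_ge1_even q1 q2 _ => a b ab; rewrite !finset.in_set => xa.
  by apply: linked_trans xa _; apply: linked_lower.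
have evenO : ~~ odd #|[set y | linked p q (outer x) (outer y)]%SET|.
  move: evenU evenL; rewrite !card_sum_set.
  set a := #|_|; set b := #|_|; set c := #|_|; set d := #|_|; set e := #|_|; set f := #|_|.
  have -> : e = a by apply: eq_card => k; rewrite !finset.in_set.
  have -> : f = d by apply: eq_card => k; rewrite !finset.in_set.
  have -> : c = b by apply: eq_card => k; rewrite !finset.in_set.
  by rewrite !oddD; case: (odd a); case: (odd b); case: (odd d).
have : 0 < #|[set y | linked p q (outer x) (outer y)]%SET :\ x|.
  have xx : x \in [set y | linked p q (outer x) (outer y)]%SET.
    by rewrite finset.in_set linked_refl.
  by rewrite (cardsD1 x) xx /= negbK in evenO; case: #|_| evenO.
move=> /card_gt0P[y]; rewrite finset.in_setD1 finset.in_set => /andP[nyx xy].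
by exists y; rewrite ?ptn_mulE // eq_sym.
Qed.

Lemma partial_brauer_closed : subsemigroup (partial_brauer n).
Proof.
by move=> p q /partial_brauerP p1 /partial_brauerP q1; apply/partial_brauerP/degree_le1_mul.
Qed.

End Brauer.

(** * Factorisations in the partial Brauer semigroup *)

(** The values at finitely many points are repaired one after the other by
   transpositions. *)
Lemma extend_perm (T : finType) (A : {set T}) (f : T -> T) :
  {in A &, injective f} -> exists g : {perm T}, {in A, g =1 f}.
Proof.
move=> fI; suff: forall s : seq T, {subset s <= A} -> exists g : {perm T}, {in s, g =1 f}.
  move=> /(_ (enum A)) []; first by move=> a; rewrite mem_enum.
  by move=> g gf; exists g => a aA; apply: gf; rewrite mem_enum.
elim=> [|a s IH] sA; first by exists 1%g.
have [|g gf] := IH; first by move=> b bs; apply: sA; rewrite inE bs orbT.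
exists (g * tperm (g a) (f a))%g => b; rewrite inE permM.
have [-> _|nba /= bs] := eqVneq b a; first by rewrite tpermL.
rewrite (gf b bs) tpermD //.
  by rewrite -(gf b bs) (inj_eq perm_inj) eq_sym.
apply: contra nba => /eqP E; apply/eqP; apply: fI => //; apply: sA.
  by rewrite inE bs orbT.
by rewrite inE eqxx.
Qed.

Section Factor.
Variable n : nat.
Implicit Types (p q : partition_sg n) (D A : {set 'I_n}) (i j k : 'I_n).

Lemma dropp_brauer D : dropp D \in partial_brauer n.
Proof.
apply/partial_brauerP => x y z; rewrite !in_kernel => /eqP xy /eqP xz nxy nxz.
have yz : drop_label D y = drop_label D z by rewrite -xy.
case: x y z xy xz yz nxy nxz => [i|i] [j|j] [k|k] //= [_ <-] [_ <-] //;
  by rewrite eqxx.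
Qed.

Lemma permp_brauer g : permp g \in partial_brauer n.
Proof.
apply/partial_brauerP => x y z; rewrite !in_kernel => /eqP xy /eqP xz nxy nxz.
have yz : perm_label g y = perm_label g z by rewrite -xy.
case: x y z xy xz yz nxy nxz => [i|i] [j|j] [k|k] //=;
  try (by move=> _ _ /perm_inj ->); try (by move=> _ _ ->);
  try (by move=> /perm_inj ->; rewrite eqxx); try (by move=> ->; rewrite eqxx);
  try (by move=> _ /perm_inj ->; rewrite eqxx); by move=> _ ->; rewrite eqxx.
Qed.

Lemma flipK : involutive (@flip n). Proof. by case. Qed.

Lemma star_brauer p : p \in partial_brauer n -> star p \in partial_brauer n.
Proof.
move=> /partial_brauerP d1; apply/partial_brauerP => x y z.
rewrite !in_star => xy xz nxy nxz; apply: (inv_inj flipK).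
by apply: d1 xy xz _ _; rewrite (inj_eq (inv_inj flipK)).
Qed.

(** Recolouring a point that [dropp D] cuts off preserves the property of being a
   colouring of the product. *)
Lemma open_top p D k y :
  dropp D ** p = p -> k \in D -> (inl k, y) \in val p -> y = inl k.
Proof.
move=> Dp kD ky; have : colours p (pred1 k) xpred0.
  rewrite -Dp colours_mul; exists xpred0; split=> [|x z _].
    apply/colours_drop => i iD /=; apply/negbTE; apply: contra iD => /eqP ->.
    exact: kD.
  by case: x; case: z.
by move=> /(_ _ _ ky) /=; rewrite eqxx; case: y ky => //= i _ /esym/eqP ->.
Qed.

Lemma star_mul p q : star (p ** q) = star q ** star p.
Proof.
apply: colours_ext => c e; rewrite colours_star !colours_mul.
by split=> -[d [a b]]; exists d; split; move: a b; rewrite !colours_star.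
Qed.

Lemma star_dropp D : star (dropp D) = dropp D.
Proof.
apply: colours_ext => c d; rewrite colours_star !colours_drop.
by split=> E k kD; rewrite E.
Qed.

Lemma open_bottom p D k y :
  p ** dropp D = p -> k \in D -> (inr k, y) \in val p -> y = inr k.
Proof.
move=> pD kD ky; have Dp : dropp D ** star p = star p by rewrite -{1}star_dropp -star_mul pD.
have := @open_top _ _ k (flip y) Dp kD; rewrite in_star flipK => /(_ ky).
by move=> /(congr1 (@flip n)); rewrite flipK.
Qed.

(** The subsemigroup [cut r] P [cut r] is a copy of the partial Brauer semigroup of
   degree [r]; working in it avoids changing the degree. *)
Definition cut r := dropp [set k : 'I_n | r <= k]%SET.

Definition rank_le r p :=
  [/\ p \in partial_brauer n, cut r ** p = p & p ** cut r = p].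

Lemma cut_idem r : cut r ** cut r = cut r. Proof. exact: dropp_idem. Qed.

Lemma rank_le_cut r : rank_le r (cut r).
Proof. by split; rewrite ?cut_idem //; apply: dropp_brauer. Qed.

Definition through_top p : {set 'I_n} :=
  [set i | [exists j, (inl i, inr j) \in val p]]%SET.

Lemma through_topP p i :
  reflect (exists j, (inl i, inr j) \in val p) (i \in through_top p).
Proof. by rewrite finset.in_set; apply: existsP. Qed.

(** A hook is a block with two points on one side; rooks are the partial
   permutations. *)
Definition top_hook p := [exists i, [exists j, (i != j) && ((inl i, inl j) \in val p)]].

Lemma top_hookP p :
  reflect (exists i j, i != j /\ (inl i, inl j) \in val p) (top_hook p).
Proof.
apply: (iffP existsP) => [[i /existsP[j /andP[ij pij]]]|[i [j [ij pij]]]].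
  by exists i, j.
by exists i; apply/existsP; exists j; rewrite ij.
Qed.

Definition rook p := ~~ top_hook p && ~~ top_hook (star p).

Lemma card_lt r : r <= n -> #|[set k : 'I_n | k < r]%SET| = r.
Proof.
move=> rn; rewrite -[RHS]card_ord -[RHS]cardsT.
have wI : injective (widen_ord rn) by move=> i j /(congr1 val) /= /val_inj.
rewrite -(card_imset _ wI); apply: eq_card => k.
rewrite finset.in_set; apply/idP/imsetP => [kr|[i _ ->]]; last exact: (ltn_ord i).
by exists (Ordinal kr) => //; apply: val_inj.
Qed.

(** Neither end of a hook belongs to a through block. *)
Lemma top_hook_bound p r : r <= n -> p \in partial_brauer n ->
  cut r ** p = p -> top_hook p -> #|through_top p| + 2 <= r.
Proof.
move=> rn /partial_brauerP d1 cp /top_hookP[i [j [ij pij]]].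
have lt_r k y : (inl k, y) \in val p -> y != inl k -> k < r.
  move=> ky; rewrite ltnNge; apply: contra => rk; apply/eqP.
  by apply: open_top cp _ ky; rewrite finset.in_set.
have ir : i < r by apply: lt_r pij _; rewrite eq_sym.
have jr : j < r by apply: lt_r (ptn_sym pij) _.
have notthr a b : a != b -> (inl a, inl b) \in val p -> a \notin through_top p.
  move=> ab pab; apply/through_topP => -[c ac].
  by have := d1 _ _ _ pab ac ab isT.
have i_thr := notthr _ _ ij pij.
have j_thr : j \notin through_top p.
  by apply: notthr (ptn_sym pij); rewrite eq_sym.
rewrite -[leqRHS](card_lt rn) addn2.
have <- : #|i |: (j |: through_top p)| = (#|through_top p|).+2.
  by rewrite cardsU1 cardsU1 finset.in_setU1 negb_or ij i_thr j_thr.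
apply/subset_leq_card/fintype.subsetP => k; rewrite [in X in _ -> X]finset.in_set.
move=> /finset.setU1P[->//|/finset.setU1P[->//|/through_topP[l kl]]].
exact: lt_r kl _.
Qed.

Lemma through_injection p : p \in partial_brauer n ->
  exists2 f : 'I_n -> 'I_n, {in through_top p &, injective f} &
    forall i, i \in through_top p -> (inl i, inr (f i)) \in val p.
Proof.
move=> /partial_brauerP d1.
pose f i := odflt i [pick j | (inl i, inr j) \in val p].
have fP i : i \in through_top p -> (inl i, inr (f i)) \in val p.
  rewrite /f => /through_topP[j ij]; case: pickP => // none.
  by have := none j; rewrite ij.
have fI : {in through_top p &, injective f}.
  move=> i j /fP ii /fP jj E; apply/eqP; apply: contraT => ij.
  have := d1 (inr (f i)) (inl i) (inl j) (ptn_sym ii).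
  by rewrite {1}E => /(_ (ptn_sym jj) isT isT) [ij']; rewrite ij' eqxx in ij.
by exists f.
Qed.

Lemma through_top_star p :
  p \in partial_brauer n -> #|through_top p| <= #|through_top (star p)|.
Proof.
move=> /through_injection[f fI fP].
rewrite -(card_in_imset fI); apply/subset_leq_card/fintype.subsetP.
move=> _ /imsetP[i /fP ii ->]; apply/through_topP; exists i.
by rewrite in_star; apply: ptn_sym.
Qed.

Lemma nonrook_bound p r : r <= n -> rank_le r p -> ~~ rook p ->
  #|through_top p| + 2 <= r.
Proof.
move=> rn [pB cp pc]; rewrite negb_and !negbK => /orP[h|h].
  exact: top_hook_bound.
apply: leq_trans (top_hook_bound rn (star_brauer pB) _ h).
  by rewrite leq_add2r through_top_star.
by rewrite -{1}[cut r]star_dropp -star_mul pc.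
Qed.

Lemma rook_factor p : p \in partial_brauer n -> rook p ->
  exists D g, p = dropp D ** permp g.
Proof.
move=> pB /andP[/top_hookP nt /top_hookP nb].
have [f fI fP] := through_injection pB; move/partial_brauerP: pB => d1.
have [g gf] := extend_perm fI.
exists (~: through_top p)%SET, g; apply: colours_ext => c e; rewrite colours_mul.
split=> [ce|[d [/colours_drop cd /colours_perm de]]].
  exists (e \o g); split; last exact/colours_perm.
  apply/colours_drop => k; rewrite finset.in_setC negbK => kT /=.
  by have /= -> := ce _ _ (fP _ kT); rewrite gf.
have cross i j : (inl i, inr j) \in val p -> c i = e j.
  move=> ij; have iT : i \in through_top p by apply/through_topP; exists j.
  rewrite cd ?finset.in_setC ?negbK // de gf //; congr e.
  by have [] := d1 _ _ _ (fP _ iT) ij isT isT.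
move=> [i|i] [j|j] ij /=.
- have [->//|nij] := eqVneq i j; case: nt; exists i, j.
  by split.
- exact: cross.
- exact/esym/cross/ptn_sym.
- have [->//|nij] := eqVneq i j; case: nb; exists i, j.
  by rewrite in_star.
Qed.

(** In p = p p^* (~: A) p of [star_drop] at most [r] points are left in the middle;
   a permutation [g] moves them into the first [r] positions. *)
Lemma nonrook_factor p r : r.+2 <= n -> rank_le r.+2 p -> ~~ rook p ->
  exists a b : partition_sg n,
    [/\ p = a ** b, a \in partial_brauer n /\ b \in partial_brauer n,
        a ** cut r = a & cut r ** b = b].
Proof.
move=> rn pr nr; have := nonrook_bound rn pr nr; rewrite addn2 !ltnS => Ar.
have [pB _ _] := pr; set A := through_top p in Ar *.
pose f i : 'I_n := odflt i (insub (index i (enum A))).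
have fA i : i \in A -> f i = index i (enum A) :> nat.
  move=> iA; rewrite /f insubT //=.
  by apply: leq_trans (leq_trans Ar (ltnW (ltnW rn))); rewrite cardE index_mem mem_enum.
have fI : {in A &, injective f}.
  move=> i j iA jA /(congr1 val) /=; rewrite !fA // => E.
  by rewrite -[LHS](nth_index i (s := enum A)) ?mem_enum // E nth_index ?mem_enum.
have [g gf] := extend_perm fI.
exists (p ** star p ** dropp (~: A)%SET ** permp g ** cut r), (cut r ** permp g^-1%g ** p).
split.
- rewrite !sg_mulA -[_ ** cut r ** cut r]sg_mulA cut_idem.
  rewrite -[_ ** permp g ** cut r]sg_mulA permp_drop sg_mulA.
  rewrite -[_ ** dropp _ ** dropp _]sg_mulA dropp_mul.
  rewrite -[_ ** permp g ** permp _]sg_mulA permp_mul mulgV -dropp0 mulr_dropp0.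
  rewrite (_ : _ :|: _ = ~: A)%SET; last first.
    apply/finset.setUidPl/fintype.subsetP => k; rewrite finset.in_set finset.in_setC.
    rewrite finset.in_set; apply: contraL => kA; rewrite -ltnNge gf // fA //.
    by apply: leq_trans Ar; rewrite cardE index_mem mem_enum.
  rewrite star_drop // => i j ij; apply/through_topP; by exists j.
- split; repeat (apply: partial_brauer_closed => //); rewrite ?dropp_brauer ?permp_brauer //.
  exact: star_brauer.
- by rewrite -sg_mulA cut_idem.
- by rewrite !sg_mulA cut_idem.
Qed.

Lemma rank_le1 p : rank_le 1 p -> p = cut 1 \/ p = dropp [set: 'I_n].
Proof.
move=> [_ cp pc].
have iso x y : (x, y) \in val p -> x != y ->
    exists i, i = 0 :> nat /\ (x = inl i \/ x = inr i).
  move=> xy nxy; case: x xy nxy => k ky nxy; exists k; split; auto;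
    apply/eqP; rewrite -leqn0 -ltnS ltnNge; apply/negP => rk;
    case/eqP: nxy; apply/esym.
    by apply: open_top cp _ ky; rewrite finset.in_set.
  by apply: open_bottom pc _ ky; rewrite finset.in_set.
have [/existsP[i /existsP[j /andP[ij pij]]]|none] :=
    boolP [exists x, [exists y, (x != y) && ((x, y) \in val p)]].
  left; have [k [k0 kx]] := iso _ _ pij ij.
  have ji : j != i by rewrite eq_sym.
  have [l [l0 ly]] := iso _ _ (ptn_sym pij) ji.
  have kl : k = l by apply: val_inj; rewrite /= k0 l0.
  have pkk : (inl k, inr k) \in val p.
    move: ij pij (ptn_sym pij); rewrite -{}kl in ly.
    by case: kx => ->; case: ly => -> //; rewrite eqxx.
  apply: colours_ext => c d; rewrite colours_drop; split=> [cd a|cd x y xy].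
    rewrite finset.in_set -ltnNge ltnS leqn0 => /eqP a0.
    have -> : a = k by apply: val_inj; rewrite /= a0 k0.
    exact: (cd _ _ pkk).
  have ck : c k = d k by apply: cd; rewrite finset.in_set k0.
  have [->//|nxy] := eqVneq x y.
  have [a [a0 ax]] := iso _ _ xy nxy.
  have nyx : y != x by rewrite eq_sym.
  have [b [b0 bx]] := iso _ _ (ptn_sym xy) nyx.
  have -> : vcol c d x = c k.
    have ak : a = k by apply: val_inj; rewrite /= a0 k0.
    by rewrite -ak in ck *; case: ax => ->.
  have bk : b = k by apply: val_inj; rewrite /= b0 k0.
  by rewrite -bk in ck *; case: bx => ->.
right; apply: colours_ext => c d; rewrite colours_drop; split=> [_ k|_ x y xy].
  by rewrite finset.in_setT.
have [->//|nxy] := eqVneq x y; case/negP: none.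
by apply/existsP; exists x; apply/existsP; exists y; rewrite nxy.
Qed.

End Factor.

(** * The complexity of the partial Brauer semigroup of odd degree *)

Section UpperBound.
Variable n : nat.
Let S := partition_sg n.

(** States of an aperiodic machine that reads a product of partial permutations and
   of partitions with hooks, up to the permutation accumulated so far. While there has
   been no hook the state is [inl D], where [D] is the set of points that are lost.
   Afterwards it is [inr (a, b)], where [a] is the left part of the first element
   with hooks and [b] the right part of the last one, or what is left of them. *)
Definition tail_mul (x y : {set 'I_n} + S * S) : {set 'I_n} + S * S :=
  match x, y with
  | inl D, inl E => inl (D :|: E)%SET
  | inl D, inr (a, b) => inr (dropp D ** a, b)
  | inr (a, b), inl D => inr (a, b ** dropp D)
  | inr (a, _), inr (_, b) => inr (a, b)
  end.

Lemma tail_mulA : associative tail_mul.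
Proof.
move=> [D|[a b]] [E|[c d]] [F|[e f]]; rewrite /tail_mul //.
- by rewrite finset.setUA.
- by rewrite -dropp_mul -sg_mulA.
- by rewrite -dropp_mul sg_mulA.
Qed.

Definition tail_sg : finSemigroup := FinSemigroup tail_mulA.

Lemma aperiodic_tail : aperiodic tail_sg.
Proof.
by apply: aperiodic_idempotents => -[D|[a b]]; rewrite /= /sg_mul /= ?finset.setUid.
Qed.

Lemma rank_le_mul r (p q : S) : rank_le r p -> rank_le r q -> rank_le r (p ** q).
Proof.
move=> [pB cp pc] [qB cq qc]; split; first exact: partial_brauer_closed.
  by rewrite sg_mulA cp.
by rewrite -sg_mulA qc.
Qed.

(** In degree 1 there are two elements, the identity and the zero. *)
Lemma computable_rank_le1 (Sigma : Type) k Y (F : seq Sigma -> Y) (mu : Y -> Sigma -> S) :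
  computable k F -> (forall y s, rank_le 1 (mu y s)) ->
  computable k (fun h => (F h, run (fun h s => mu (F h) s) h)).
Proof.
move=> kF mu1.
pose mu' y s : bool_sg := mu y s == cut n 1.
pose f (b : bool_sg) := if b then cut n 1 else dropp [set: 'I_n].
have fM : {morph f : b c / b ** c}.
  have cT : cut n 1 ** dropp [set: 'I_n] = dropp [set: 'I_n].
    by rewrite dropp_mul finset.setUT.
  have Tc : dropp [set: 'I_n] ** cut n 1 = dropp [set: 'I_n].
    by rewrite dropp_mul finset.setTU.
  by case=> [] [] /=; rewrite ?cut_idem ?dropp_idem ?cT ?Tc.
have muE y s : mu y s = f (mu' y s).
  by rewrite /f /mu'; case: eqP => // ne; case: (rank_le1 (mu1 y s)).
have kF' := computable_aperiodic mu' aperiodic_bool kF.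
apply: (computable_post (f := fun yb => (yb.1, omap f yb.2)) kF') => h /=.
congr pair; elim: h => //= s h ->; rewrite muE.
by case: (run _ h) => //= b; rewrite fM.
Qed.

(** Let a product of elements of degree [r.+2] be read. A partial permutation
   [dropp D ** permp g] is absorbed into the accumulated permutation [u], after its
   points [D] have been moved to where they were before [u]; this makes the effect on
   the other machines a product of idempotents. An element with hooks factors as
   [a' ** b'] through [cut r]. It sends the product of the previous right part, [u]
   and [a'] to the machine of degree [r], and resets the right part to [b'], moved
   back by the inverse of [u] to cancel the permutation that is applied at the end.
   The product is recovered by the function [total]. *)
Lemma computable_rank_le m (Sigma : Type) k Y (F : seq Sigma -> Y)
    (mu : Y -> Sigma -> S) :
  2 * m + 1 <= n -> computable k F -> (forall y s, rank_le (2 * m + 1) (mu y s)) ->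
  computable (k + m) (fun h => (F h, run (fun h s => mu (F h) s) h)).
Proof.
elim: m Sigma k Y F mu => [|m IH] Sigma k Y F mu rn kF mur.
  by rewrite addn0; apply: computable_rank_le1.
set r := 2 * m + 1 in IH; have r2 : 2 * m.+1 + 1 = r.+2 by rewrite /r; lia.
rewrite {}r2 in rn mur.
have /choice[rookf rookP] (p : S) : exists f : {set 'I_n} * 'S_n,
    rank_le r.+2 p -> rook p -> p = dropp f.1 ** permp f.2.
  have [[[pB _ _] pr]|no] := pselect (rank_le r.+2 p /\ rook p).
    by have [D [g E]] := rook_factor pB pr; exists (D, g).
  by exists (finset.set0, 1%g) => p1 p2; case: no.
have /choice[facf facP] (p : S) : exists f : S * S, rank_le r.+2 p -> ~~ rook p ->
    [/\ p = f.1 ** f.2, f.1 \in partial_brauer n /\ f.2 \in partial_brauer n,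
        f.1 ** cut n r = f.1 & cut n r ** f.2 = f.2].
  have [[pr nr]|no] := pselect (rank_le r.+2 p /\ ~~ rook p).
    by have [a [b E]] := nonrook_factor rn pr nr; exists (a, b).
  by exists (p, p) => p1 p2; case: no.
pose gam (g : option 'S_n) : 'S_n := odflt 1%g g.
pose mug y s : 'S_n := if rook (mu y s) then (rookf (mu y s)).2 else 1%g.
(* the machine for the group is never reset: an element with hooks counts as the
   identity *)
pose g h := run (fun h s => mug (F h) s : group_sg 'S_n) h.
have kF1 : computable k.+1 (fun h => (F h, g h)) := computable_group mug kF.
pose mub (yg : Y * option 'S_n) s : tail_sg :=
  let p := mu yg.1 s in let g := gam yg.2 in
  if rook p then inl [set i | g i \in (rookf p).1]%SET
  else inr (permp g ** (facf p).1, (facf p).2 ** permp g^-1%g).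
pose x h := run (fun h s => mub (F h, g h) s) h.
have kF2 : computable k.+1 (fun h => ((F h, g h), x h)) :=
  computable_aperiodic mub aperiodic_tail kF1.
(* an arbitrary [b] could lead out of the corner of degree [r], hence the test; the
   states that occur pass it *)
pose muq (ygb : (Y * option 'S_n) * option tail_sg) s : S :=
  let p := mu ygb.1.1 s in
  let c := if ygb.2 is Some (inr (a, b)) then
             b ** permp (gam ygb.1.2) ** (facf p).1 else cut n r in
  if ~~ rook p && `[< rank_le r c >] then c else cut n r.
have muqr y s : rank_le r (muq y s).
  rewrite /muq; case: ifP => [/andP[_ /asboolP //]|_]; exact: rank_le_cut.
pose c h := run (fun h s => muq ((F h, g h), x h) s) h.
have kF3 : computable (k.+1 + m) (fun h => (((F h, g h), x h), c h)) :=
  IH _ _ _ _ muq (ltnW (ltnW rn)) kF2 muqr.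
pose total (x : option tail_sg) (g : 'S_n) (c : option S) : option S :=
  omap (fun x => match x with
    | inl D => dropp D ** permp g
    | inr (a, b) => a ** odflt (cut n r) c ** b ** permp g
    end) x.
pose good (x : option tail_sg) (g : 'S_n) (c : option S) := match x with
  | None => g = 1%g /\ odflt (cut n r) c = cut n r
  | Some (inl D) => odflt (cut n r) c = cut n r
  | Some (inr (a, b)) => [/\ exists2 c', c = Some c' & rank_le r c',
      a ** cut n r = a, cut n r ** b = b & b \in partial_brauer n]
  end.
rewrite -addSnnS.
apply: (computable_post (f := fun t => (t.1.1.1, total t.1.2 (gam t.1.1.2) t.2)) kF3).
move=> h; congr pair => /=.
suff: good (x h) (gam (g h)) (c h) /\
    run (fun h s => mu (F h) s) h = total (x h) (gam (g h)) (c h) by case.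
elim: h => // s h [gd tot].
have gamS : gam (g (s :: h)) = (gam (g h) * mug (F h) s)%g.
  by rewrite /g /= -/(g h); case: (g h) => [u|] //=; rewrite mul1g.
rewrite gamS /x /c /= -/(x h) -/(c h) tot.
move: gd; rewrite /mub /muq /mug /=.
set p := mu (F h) s; set u := gam (g h); have pr : rank_le r.+2 p by apply: mur.
have uV : permp u^-1%g ** permp u = dropp finset.set0 :> S.
  by rewrite permp_mul mulVg dropp0.
have cutA c0 : odflt (cut n r) c0 = cut n r ->
    exists2 c', actI c0 (cut n r) = Some c' & c' = cut n r.
  by case: c0 => [c0|] /=; [move=> ->; exists (cut n r ** cut n r) => //; apply: cut_idem
                            |exists (cut n r)].
have [rk|nrk] := boolP (rook p).
  have pE := rookP p pr rk.
  have move_p : permp u ** p =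
      dropp [set i | u i \in (rookf p).1]%SET ** permp (u * (rookf p).2)%g.
    by rewrite {1}pE sg_mulA permp_drop -sg_mulA permp_mul.
  case: (x h) => [[D|[a b]]|] /=.
  - move=> /cutA[c' -> ->] /=; split => //.
    by rewrite -dropp_mul -!sg_mulA move_p.
  - move=> [[c' -> cr] acut cutb bB] /=; have [_ _ cc] := cr.
    rewrite cc; split.
      split => //; [by exists c'|by rewrite sg_mulA cutb|].
      by apply: partial_brauer_closed => //; apply: dropp_brauer.
    by rewrite -!sg_mulA -move_p !sg_mulA.
  - move=> [u1 /cutA[c' -> ->]] /=; split => //.
    by rewrite -move_p u1 -dropp0 mul_dropp0.
have [pE [aB bB] acut cutb] := facP p pr nrk.
have acutA z : (facf p).1 ** (cut n r ** z) = (facf p).1 ** z.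
  by rewrite sg_mulA acut.
have goodb : cut n r ** ((facf p).2 ** permp u^-1%g) = (facf p).2 ** permp u^-1%g /\
    (facf p).2 ** permp u^-1%g \in partial_brauer n.
  split; first by rewrite sg_mulA cutb.
  by apply: partial_brauer_closed => //; apply: permp_brauer.
case: (x h) => [[D|[a b]]|] /=.
- rewrite if_same => /cutA[c' -> ->] /=; split.
    case: goodb => g1 g2; split => //; last by rewrite -!sg_mulA acut.
    by exists (cut n r) => //; apply: rank_le_cut.
  by rewrite mulg1 -!sg_mulA uV mulr_dropp0 acutA -pE.
- move=> [[c' -> cr] acut' cutb' bB'] /=.
  have er : rank_le r (b ** permp u ** (facf p).1).
    split; last by rewrite -!sg_mulA acut.
      by repeat apply: partial_brauer_closed => //; apply: permp_brauer.
    by rewrite !sg_mulA cutb'.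
  have -> : `[< rank_le r (b ** permp u ** (facf p).1) >] by apply/asboolP.
  split.
    case: goodb => g1 g2; split => //.
    by eexists; [reflexivity|apply: rank_le_mul].
  by rewrite mulg1 -!sg_mulA uV mulr_dropp0 -pE.
- move=> [u1]; rewrite if_same => /cutA[c' -> ->] /=; split.
    case: goodb => g1 g2; split => //; last by rewrite -!sg_mulA acut.
    by exists (cut n r) => //; apply: rank_le_cut.
  by rewrite mulg1 -!sg_mulA uV mulr_dropp0 u1 -dropp0 mul_dropp0 acutA -pE.
Qed.

Lemma kr_bound_partial_brauer m : n = 2 * m + 1 -> kr_bound (partial_brauer n) m.
Proof.
move=> nm.
pose Sigma := {x : S | x \in partial_brauer n}.
apply: (@kr_bound_computable _ _ _ (dropp finset.set0)).
  exact: partial_brauer_closed.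
have c0 : computable 0 (fun _ : seq Sigma => tt) := computable_const Sigma tt.
have full (s : Sigma) : rank_le (2 * m + 1) (val s).
  have cut1 : cut n (2 * m + 1) = dropp finset.set0.
    congr dropp; apply/setP => k; rewrite !finset.in_set.
    by apply/negbTE; rewrite -ltnNge -nm.
  by split; rewrite ?cut1 ?mul_dropp0 ?mulr_dropp0 //; apply: valP.
have := @computable_rank_le m Sigma 0 unit _ (fun _ s => val s) _ c0 (fun _ => full).
rewrite -nm => /(_ (leqnn _)) cm.
exact: (computable_post (f := snd) cm).
Qed.

End UpperBound.

(** * Rotations with hooks *)

Section Rotations.
Variable N : nat.
Let S := partition_sg N.

(** The first [r] points are turned by [j] steps; on either side, the remaining ones
   are joined in pairs of neighbours. For [j] = 0 these are idempotents, which form a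
   chain as [r] runs through the numbers of the parity of [N]. *)
Definition rot_label r j (x : vertex N) : nat * nat :=
  match x with
  | inl k => if k < r then (0, (k + j) %% r) else (1, (k - r)./2)
  | inr k => if k < r then (0, nat_of_ord k) else (2, (k - r)./2)
  end.

Definition rotp r j : S := kernel (rot_label r j).

Definition hooked r (c : nat -> bool) :=
  forall i, r + 2 * i + 1 < N -> c (r + 2 * i) = c (r + 2 * i + 1).

Lemma colours_rot r j (c d : nat -> bool) : 0 < r -> r <= N -> ~~ odd (N - r) ->
  colours (rotp r j) (c \o val) (d \o val) <->
  [/\ forall k, k < r -> c k = d ((k + j) %% r), hooked r c & hooked r d].
Proof.
move=> r0 rN even; split=> [cd|[cd hc hd] x y].
  split=> [k kr|i iN|i iN].
  - have kN : k < N by apply: leq_trans rN.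
    have lr : (k + j) %% r < r by rewrite ltn_mod.
    have lN : (k + j) %% r < N by apply: leq_trans rN.
    apply: (cd (inl (Ordinal kN)) (inr (Ordinal lN))).
    by rewrite in_kernel /= kr lr.
  - have iN' : r + 2 * i < N by lia.
    apply: (cd (inl (Ordinal iN')) (inl (Ordinal iN))); rewrite in_kernel /=.
    by rewrite !ifF; [apply/eqP; congr pair; lia|lia|lia].
  - have iN' : r + 2 * i < N by lia.
    apply: (cd (inr (Ordinal iN')) (inr (Ordinal iN))); rewrite in_kernel /=.
    by rewrite !ifF; [apply/eqP; congr pair; lia|lia|lia].
have hook (f : nat -> bool) (k l : 'I_N) : hooked r f -> r <= k -> r <= l ->
    (k - r)./2 = (l - r)./2 -> f k = f l.
  move=> hf rk rl kl.
  suff key (m : 'I_N) : r <= m -> f m = f (r + 2 * (m - r)./2).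
    by rewrite key // kl -key.
  move=> rm; have mN := ltn_ord m.
  have [E|E] : m = r + 2 * (m - r)./2 :> nat \/ m = r + 2 * (m - r)./2 + 1 :> nat.
  - by lia.
  - by rewrite -E.
  - by rewrite {1}E -hf //; lia.
have inj (k l : nat) : k < r -> l < r -> (k + j) %% r = (l + j) %% r -> k = l.
  by move=> kr lr /eqP; rewrite eqn_modDr !modn_small // => /eqP.
rewrite in_kernel => /eqP; case: x y => [k|k] [l|l] /=;
  case: ltnP => kr; case: ltnP => lr // -[] kl.
- by rewrite (inj k l).
- exact: hook.
- by rewrite cd // kl.
- by rewrite cd // -kl.
- by rewrite kl.
- exact: hook.
Qed.

Lemma colours_nat (c : 'I_N -> bool) : exists c' : nat -> bool, c = c' \o val.
Proof.
exists (fun i => if insub i is Some k then c k else true).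
by apply/funext => k /=; rewrite valK.
Qed.

Lemma rot_ext (p q : S) : (forall c d : nat -> bool,
  colours p (c \o val) (d \o val) <-> colours q (c \o val) (d \o val)) -> p = q.
Proof.
move=> E; apply: colours_ext => c d.
have [c' ->] := colours_nat c; have [d' ->] := colours_nat d; exact: E.
Qed.

Lemma colours_mul_nat (p q : S) (c e : nat -> bool) :
  colours (p ** q) (c \o val) (e \o val) <->
  exists d : nat -> bool, colours p (c \o val) (d \o val) /\
    colours q (d \o val) (e \o val).
Proof.
rewrite colours_mul; split=> [[d]|[d pq]]; last by exists (d \o val).
by have [d' ->] := colours_nat d; exists d'.
Qed.

Lemma rot_mod r i j : i = j %[mod r] -> rotp r i = rotp r j.
Proof.
move=> ij; rewrite /rotp; have -> // : rot_label r i = rot_label r j.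
apply/funext => -[k|k] //=; case: ifP => // _; congr pair.
by rewrite -modnDmr ij modnDmr.
Qed.

Lemma hooked_ext r (c d : nat -> bool) :
  (forall k, r <= k -> c k = d k) -> hooked r c -> hooked r d.
Proof. by move=> cd hc i iN; rewrite -!cd ?hc //; lia. Qed.

Lemma rot_mul r i j : 0 < r -> r <= N -> ~~ odd (N - r) ->
  rotp r i ** rotp r j = rotp r (i + j).
Proof.
move=> r0 rN ev; apply: rot_ext => c e; rewrite colours_mul_nat colours_rot //.
split=> [[d []]|[ce hc he]].
  rewrite !colours_rot // => -[cd hc _] [de _ he]; split => // k kr.
  by rewrite cd // de ?ltn_mod // modnDml addnA.
exists (fun l => if l < r then e ((l + j) %% r) else true).
rewrite !colours_rot //; split; split => // k; rewrite ?ltn_mod ?r0.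
- by move=> kr; rewrite ce // modnDml addnA.
- by move=> _; rewrite !ifF //; lia.
- by move=> ->.
- by move=> _; rewrite !ifF //; lia.
Qed.

Lemma spow_rot r j k : 0 < r -> r <= N -> ~~ odd (N - r) ->
  spow (rotp r j) k = rotp r (k.+1 * j).
Proof.
move=> r0 rN ev; elim: k => [|k IH]; first by rewrite mul1n.
by rewrite /= IH rot_mul // [in RHS]mulSnr.
Qed.

Lemma modn_wrap k j r : k < r -> j <= r ->
  (k + j) %% r = if k + j < r then k + j else k + j - r.
Proof.
move=> kr jr; case: ltnP => h; first by rewrite modn_small.
by rewrite -{1}(subnK h) modnDr modn_small //; lia.
Qed.

Lemma hookedW r (c : nat -> bool) : c r = c r.+1 -> hooked r.+2 c -> hooked r c.
Proof.
move=> cr hc [|i] iN; first by rewrite muln0 addn0 addn1.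
by have := hc i; rewrite (_ : r + 2 * i.+1 = r.+2 + 2 * i); [apply|]; lia.
Qed.

Lemma hookedS r (c : nat -> bool) : r.+2 <= N -> hooked r c -> c r = c r.+1 /\ hooked r.+2 c.
Proof.
move=> rN hc; split; first by have := hc 0; rewrite muln0 addn0 addn1; apply.
by move=> i iN; have := hc i.+1; rewrite (_ : r + 2 * i.+1 = r.+2 + 2 * i); [apply|]; lia.
Qed.

Lemma modn_add0 k r : k < r -> (k + 0) %% r = k.
Proof. by move=> kr; rewrite addn0 modn_small. Qed.

Section Step.
Variable s : nat.
Hypotheses (s0 : 0 < s) (sN : s.+2 <= N) (ev : ~~ odd (N - s)).

Let ev2 : ~~ odd (N - s.+2). Proof. by have := ev; lia. Qed.
Let sN' : s <= N. Proof. by lia. Qed.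

Lemma rot_absorb_l : rotp s.+2 0 ** rotp s 0 = rotp s 0.
Proof.
apply: rot_ext => c e; rewrite colours_mul_nat colours_rot //.
split=> [[d []]|[ce hc he]].
  rewrite !colours_rot // => -[cd hc hd] [de hd' he]; split => //.
    by move=> k ks; rewrite cd ?modn_add0 ?de ?modn_add0 //; lia.
  have [dd _] := hookedS sN hd'; apply: hookedW => //.
  by rewrite !cd ?modn_add0.
exists c; rewrite !colours_rot //; have [cc hc'] := hookedS sN hc.
by split; split => // k kr; rewrite modn_add0.
Qed.

Lemma rot_absorb_r : rotp s 0 ** rotp s.+2 0 = rotp s 0.
Proof.
apply: rot_ext => c e; rewrite colours_mul_nat colours_rot //.
split=> [[d []]|[ce hc he]].
  rewrite !colours_rot // => -[cd hc hd] [de hd' he]; split => //.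
    by move=> k ks; rewrite cd ?modn_add0 ?de ?modn_add0 //; lia.
  have [dd _] := hookedS sN hd; apply: hookedW => //.
  by have := de s; have := de s.+1; rewrite !modn_add0 // => <- // <- //.
exists e; rewrite !colours_rot //; have [cc he'] := hookedS sN he.
by split; split => // k kr; rewrite modn_add0.
Qed.

(** The last of the first [s] points is sent to the point [s], which the hooks on
   both sides of the rotation carry along the two extra points to 0. *)
Lemma rot_compress : rotp s 0 ** rotp s.+2 1 ** rotp s 0 = rotp s 1.
Proof.
apply: rot_ext => c e; rewrite colours_mul_nat colours_rot //.
split=> [[d2 []]|[ce hc he]].
  rewrite colours_mul_nat colours_rot // => -[d1 []].
  rewrite !colours_rot // => -[cd1 hc hd1] [d12 _ _] [d2e hd2 he]; split => // k ks.
  have [d1s _] := hookedS sN hd1; have [d2s _] := hookedS sN hd2.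
  rewrite cd1 // modn_add0 // d12 ?modn_wrap //; try lia.
  have [kls|ksl] := ltnP (k + 1) s.
    by rewrite ifT ?d2e ?modn_add0 //; lia.
  have -> : k = s.-1 by lia.
  rewrite ifT; last by lia.
  have -> : s.-1 + 1 = s by lia.
  rewrite subnn d2s.
  have E1 : d1 s = d2 s.+1 by rewrite d12 // modn_wrap // addn1 ltnSn.
  have E2 : d1 s.+1 = d2 0 by rewrite d12 // modn_wrap // addn1 ltnn subnn.
  by rewrite -E1 d1s E2 d2e // modn_add0.
pose d1 k := if k < s then c k else e 0.
pose d2 k := if k < s then e k else e 0.
exists d2; rewrite colours_mul_nat !colours_rot //; split; last first.
  split=> // [k ks|i _]; first by rewrite modn_add0 // /d2 ks.
  by rewrite /d2 !ifF //; lia.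
exists d1; rewrite !colours_rot //.
have h1 : hooked s d1 by move=> i _; rewrite /d1 !ifF //; lia.
have h2 : hooked s d2 by move=> i _; rewrite /d2 !ifF //; lia.
have [_ h1'] := hookedS sN h1; have [_ h2'] := hookedS sN h2.
split; split => //; first by move=> k ks; rewrite modn_add0 // /d1 ks.
move=> k ks; rewrite modn_wrap // /d1 /d2; have [kls|ksl] := ltnP k s.
  rewrite (_ : (k + 1 < s.+2) = true); last by lia.
  by rewrite ce // modn_wrap //; case: ltnP => // h; congr e; lia.
case: (ltnP (k + 1) s.+2) => h; first by rewrite ifF //; lia.
by rewrite ifT; [congr e; lia|lia].
Qed.

End Step.

Lemma shift_back s k : k < s.+4 ->
  (k + s.+2) %% s.+4 = if k < 2 then k + s.+2 else k - 2.
Proof.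
move=> ks; rewrite modn_wrap //; last by lia.
case: (ltnP k 2) => k2.
  by rewrite ifT //; lia.
by rewrite ifF; lia.
Qed.

Lemma shift_forth s k : k < s.+4 ->
  (k + 2) %% s.+4 = if k < s.+2 then k.+2 else k - s.+2.
Proof.
move=> ks; rewrite modn_wrap //.
case: (ltnP k s.+2) => k2.
  by rewrite ifT addn2.
by rewrite ifF; lia.
Qed.

(** Conjugation by two steps of the rotation moves the hook of [rotp s.+2 0] at
   [s.+2] and [s.+3] to [s] and [s.+1]; multiplication by [rotp s.+2 0] restores the
   former. *)
Lemma rot_shift_hook s : 0 < s -> s.+4 <= N -> ~~ odd (N - s) ->
  rotp s 0 = rotp s.+2 0 ** rotp s.+4 2 ** rotp s.+2 0 ** rotp s.+4 s.+2.
Proof.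
move=> s0 sN ev; have ev2 : ~~ odd (N - s.+2) by lia.
have ev4 : ~~ odd (N - s.+4) by lia.
have sN0 : s <= N by lia. have sN2 : s.+2 <= N by lia.
have lt23 : s.+2 < s.+4 by lia.
have lt12 : s.+1 < s.+4 by lia.
have B2 : (s.+2 + s.+2) %% s.+4 = s by rewrite shift_back // subn2.
have B3 : (s.+3 + s.+2) %% s.+4 = s.+1 by rewrite shift_back // subn2.
apply: rot_ext => c e; rewrite colours_mul_nat colours_rot //.
split=> [[ce hc he]|[d2 []]].
  have [cs hc2] := hookedS sN2 hc; have [es he2] := hookedS sN2 he.
  have [es2 he4] := hookedS sN he2.
  pose d0 k := if k < s.+2 then c k else e k.
  pose d1 k := if k < s.+4 then d0 ((k + s.+2) %% s.+4) else e k.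
  pose d2 k := if k < s.+4 then e ((k + s.+2) %% s.+4) else e k.
  have d0ge k : s.+2 <= k -> e k = d0 k by move=> h; rewrite /d0 ltnNge h.
  have d1ge k : s.+4 <= k -> e k = d1 k by move=> h; rewrite /d1 ltnNge h.
  have d2ge k : s.+4 <= k -> e k = d2 k by move=> h; rewrite /d2 ltnNge h.
  have d1lt k : k < s.+4 -> d1 k = d0 ((k + s.+2) %% s.+4) by rewrite /d1 => ->.
  have d2lt k : k < s.+4 -> d2 k = e ((k + s.+2) %% s.+4) by rewrite /d2 => ->.
  have d0lt k : k < s.+2 -> d0 k = c k by rewrite /d0 => ->.
  clearbody d0 d1 d2.
  have hd0 : hooked s.+2 d0 by apply: hooked_ext he2.
  have [_ hd0'] := hookedS sN hd0.
  have hd1' : hooked s.+4 d1 by apply: hooked_ext he4.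
  have hd2' : hooked s.+4 d2 by apply: hooked_ext he4.
  have d1s : d1 s.+2 = d1 s.+3 by rewrite !d1lt // B2 B3 !d0lt.
  have d2s : d2 s.+2 = d2 s.+3 by rewrite !d2lt // B2 B3.
  have hd1 : hooked s.+2 d1 by apply: hookedW.
  have hd2 : hooked s.+2 d2 by apply: hookedW.
  exists d2; rewrite colours_mul_nat colours_rot //; split; last first.
    by split => // k ks; apply: d2lt.
  exists d1; rewrite colours_mul_nat colours_rot //; split; last first.
    split=> // k ks; have ks' : k < s.+4 by apply: ltnW (ltnW _).
    rewrite modn_add0 // d1lt // d2lt // shift_back //; case: ifP => [k2|/negbT].
      by rewrite -d0ge // leq_addl.
    rewrite -leqNgt => k2; have k2s : k - 2 < s by rewrite ltn_subLR.
    by rewrite d0lt ?ce ?modn_add0 // (ltn_trans k2s).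
  exists d0; rewrite !colours_rot //; split; split=> // k ks.
    by rewrite modn_add0 // d0lt.
  rewrite d1lt ?ltn_mod // modnDml -addnA.
  by rewrite (_ : 2 + s.+2 = s.+4) // modnDr modn_small.
rewrite colours_mul_nat colours_rot // => -[d1 []].
rewrite colours_mul_nat colours_rot // => -[d0 []].
rewrite !colours_rot // => -[cd0 hc hd0] [d01 _ _] [d12 hd1 hd2] [d2e _ he].
have [d0s _] := hookedS sN hd0; have [d1s _] := hookedS sN hd1.
have [d2s _] := hookedS sN hd2.
have d01' k : k < s.+2 -> d0 k = d1 k.+2.
  by move=> ks; rewrite d01 ?shift_forth ?ks // ltnW // ltnW.
have d2e' k : 1 < k -> k < s.+4 -> d2 k = e (k - 2).
  by move=> k1 ks; rewrite d2e // shift_back // ltnNge k1.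
have cd0' k : k < s.+2 -> c k = d0 k by move=> ks; rewrite cd0 ?modn_add0.
have d12' k : k < s.+2 -> d1 k = d2 k by move=> ks; rewrite d12 ?modn_add0.
have ces : e s = e s.+1.
  by have := d2e' s.+2 isT lt23; have := d2e' s.+3 isT (ltnSn _);
     rewrite !subn2 /= => <- <-.
have es2 : e s.+2 = e s.+3.
  have E0 : d2 0 = e s.+2 by rewrite d2e // shift_back.
  have E1 : d2 1 = e s.+3 by rewrite d2e // shift_back.
  have F0 : d0 s.+2 = d1 0 by rewrite d01 // shift_forth // ltnn subnn.
  have F1 : d0 s.+3 = d1 1 by rewrite d01 // shift_forth // ltnNge leqnSn subSnn.
  by rewrite -E0 -E1 -!d12' // -F0 -F1.
split=> [k ks||].
- have ks2 : k < s.+2 by apply: ltnW (ltnW _).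
  by rewrite modn_add0 // cd0' // d01' // d12' // d2e' // subn2.
- by apply: hookedW => //; rewrite !cd0' // !d01'.
- by apply: hookedW => //; apply: hookedW.
Qed.

(** The colouring in which 0 is the only point of its colour on either side belongs
   to [rotp s 0], but not to the product. *)
Lemma rot_neq s : 0 < s -> s.+2 <= N -> ~~ odd (N - s) ->
  rotp s 0 ** rotp s.+2 1 != rotp s 0.
Proof.
move=> s0 sN ev; apply/eqP => E.
have sN0 : s <= N by lia.
have ev2 : ~~ odd (N - s.+2) by lia.
pose f k := k == 0.
have fh : hooked s f by move=> i _; rewrite /f; lia.
have : colours (rotp s 0) (f \o val) (f \o val).
  by rewrite colours_rot //; split => // k ks; rewrite modn_add0.
rewrite -E colours_mul_nat => -[d []]; rewrite !colours_rot // => -[fd _ _] [df _ _].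
by have := fd 0 s0; rewrite modn_add0 // df // modn_small.
Qed.

(** By [rot_compress] the power of exponent [r] = [s.+2] of [rotp s 1] is the
   alternating product of [e] = [rotp s 0] and [r] factors [rotp r 1]. The power of
   exponent [r] of [rotp r 1] is an identity for [e], so moving these factors to the
   right turns the product into one of conjugates of [e], which are idempotents.
   Modulo [s] the exponent [r] is 2, and so a unit because [s] is odd. *)
Lemma rot_descend s (Q D : {set S}) : 0 < s -> s.+2 <= N -> ~~ odd (N - s) -> odd s ->
  subsemigroup Q -> subsemigroup D ->
  (forall a, a \in Q -> a ** a = a -> a \in D) ->
  rotp s.+2 1 \in Q -> rotp s 0 \in Q ->
  rotp s 1 \in D /\ (2 < s -> rotp s.-2 0 \in D).
Proof.
move=> s0 sN ev os cQ cD QD rQ eQ.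
have sN0 : s <= N by lia.
have ev2 : ~~ odd (N - s.+2) by lia.
set e := rotp s 0 in eQ *; set r := s.+2.
have ee : e ** e = e by rewrite rot_mul.
have rotQ j : 0 < j -> rotp r j \in Q.
  case: j => // j _; rewrite -[j.+1]muln1 -spow_rot //; exact: spow_closed.
have full : rotp r r = rotp r 0 by apply: rot_mod; rewrite modnn mod0n.
pose X j := rotp r j ** e ** rotp r (r - j).
have eX j : j <= r -> X j ** rotp r j = rotp r j ** e.
  move=> jr; rewrite /X -sg_mulA rot_mul // subnK // full -sg_mulA.
  by rewrite rot_absorb_r.
have XD j : 0 < j -> j < r -> X j \in D.
  move=> j0 jr; apply: QD.
    by apply: (cQ); [apply: (cQ) => //|]; apply: rotQ; lia.
  by rewrite {2}/X !sg_mulA eX 1?ltnW // -[_ ** e ** e]sg_mulA ee.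
have eD : e \in D by apply: QD.
have rho_e : rotp s 1 ** e = rotp s 1 by rewrite rot_mul.
have spow_e j : spow (rotp s 1) j ** e = spow (rotp s 1) j.
  by case: j => [|j] /=; rewrite -?sg_mulA rho_e.
(* [z] is a product of conjugates of [e]; the rotations have been moved past it *)
have prodD j : j < r -> exists2 z, z \in D &
    z ** rotp r j = if j is i.+1 then spow (rotp s 1) i else e.
  elim: j => [|j IH] jr; first by exists e; rewrite ?rot_absorb_r.
  have [z zD zj] := IH (ltnW jr); exists (z ** X j.+1).
    by apply: cD => //; apply: XD.
  rewrite -sg_mulA eX 1?ltnW // sg_mulA -addn1 -rot_mul // sg_mulA {}zj.
  case: j {IH jr} => [|j]; first exact: rot_compress.
  by rewrite -spow_e -!sg_mulA [e ** (_ ** _)]sg_mulA rot_compress.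
have XrD : rotp s 2 \in D.
  have [z zD zr] := prodD s.+1 (ltnSn _).
  have -> : rotp s 2 = spow (rotp s 1) s.+1.
    rewrite spow_rot //; apply: rot_mod.
    by rewrite muln1 -[s.+2]addn2 modnDl.
  have <- : z ** e = spow (rotp s 1) s.+1; last exact: cD.
  have -> : spow (rotp s 1) s.+1 = spow (rotp s 1) s ** e ** rotp r 1 ** e.
    by rewrite -!sg_mulA [e ** (_ ** _)]sg_mulA rot_compress.
  rewrite spow_e.
  rewrite -zr -[_ ** _ ** rotp _ 1]sg_mulA rot_mul // addn1 full -sg_mulA.
  by rewrite rot_absorb_l.
split=> [|s2].
  have -> : rotp s 1 = spow (rotp s 2) (s.+1./2.-1).
    rewrite spow_rot //; apply: rot_mod.
    have -> : s.+1./2.-1.+1 * 2 = 1 + s by lia.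
    by rewrite modnDr.
  exact: spow_closed.
have [t st] : exists t, s = t.+2 by exists s.-2; lia.
have -> : rotp s.-2 0 = e ** X 2.
  rewrite /X /r /e st subn2 !sg_mulA.
  by apply: rot_shift_hook; move: s2 sN ev; rewrite st; clear; lia.
by apply: cD => //; apply: XD => //; rewrite /r; lia.
Qed.

End Rotations.

Lemma kr_bound_annular_lower n (A : {set partition_sg (2 * n - 1)}) k :
  1 < n -> rotp (2 * n - 1) (2 * n - 1) 1 \in A ->
  rotp (2 * n - 1) (2 * n - 3) 0 \in A -> kr_bound A k -> n - 1 <= k.
Proof.
move=> n1; set N := 2 * n - 1 => rA eA.
pose r i := N - 2 * i.
apply: (@kr_bound_lower _ (n - 1) (fun i => rotp N (r i) 1)
  (fun i => rotp N (r i) 0) (fun i => (r i).-1)); last 2 first.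
- by rewrite /r muln0 subn0.
- by rewrite (_ : r 1 = 2 * n - 3) // /r /N; lia.
- move=> i iL; have ri : 0 < r i by rewrite /r /N; lia.
  rewrite spow_rot ?prednK ?muln1 //; try (by rewrite /r /N; lia).
  by apply: rot_mod; rewrite modnn mod0n.
- by move=> i iL; rewrite rot_mul //; rewrite /r /N; lia.
- by move=> i iL; rewrite rot_mul //; rewrite /r /N; lia.
- move=> i iL; have -> : r i = (r i.+1).+2 by rewrite /r /N; lia.
  by split; [apply: rot_absorb_l|apply: rot_absorb_r]; rewrite /r /N; lia.
- move=> i iL; have -> : r i = (r i.+1).+2 by rewrite /r /N; lia.
  by apply: rot_neq; rewrite /r /N; lia.
move=> i Q D iL cQ cD QD; have -> : r i = (r i.+1).+2 by rewrite /r /N; lia.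
move=> rQ eQ; have [|||| r1 e2] := rot_descend _ _ _ _ cQ cD QD rQ eQ;
  try by rewrite /r /N; lia.
split => //; have -> : r i.+2 = (r i.+1).-2 by rewrite /r /N; lia.
by apply: e2; rewrite /r /N; lia.
Qed.

Section Degrees.
Variables (N r j : nat).
Hypotheses (r0 : 0 < r) (rN : r <= N) (ev : ~~ odd (N - r)).

Lemma rot_degree_le1 : degree_le1 (rotp N r j).
Proof.
have inj (k l : 'I_N) : k < r -> l < r -> (k + j) %% r = (l + j) %% r -> k = l.
  move=> kr lr /eqP; rewrite eqn_modDr !modn_small // => /eqP; exact: val_inj.
have hook (k l m : 'I_N) : r <= k -> r <= l -> r <= m -> (k - r)./2 = (l - r)./2 ->
    (k - r)./2 = (m - r)./2 -> k != l -> k != m -> l = m.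
  move=> rk rl rm kl km /eqP nkl /eqP nkm; apply: val_inj => /=.
  have nkl' : nat_of_ord k <> l by move=> /val_inj.
  have nkm' : nat_of_ord k <> m by move=> /val_inj.
  lia.
move=> x y z; rewrite !in_kernel => /eqP xy /eqP xz.
case: x y z xy xz => [k|k] [l|l] [m|m] /=;
  case: (ltnP k r) => kr; case: (ltnP l r) => lr; case: (ltnP m r) => mr // -[kl] -[km] nkl nkm.
- by rewrite (inj k l) ?eqxx in nkl.
- by congr inl; apply: (hook k).
- by rewrite (inj k l) ?eqxx in nkl.
- by rewrite (inj k m) ?eqxx in nkm.
- by congr inr; apply: val_inj; rewrite /= -kl -km.
- by congr inl; apply: inj => //; rewrite -kl -km.
- by rewrite (val_inj km) eqxx in nkm.
- by rewrite (val_inj kl) eqxx in nkl.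
- by rewrite (val_inj kl) eqxx in nkl.
- by congr inr; apply: (hook k).
Qed.

Lemma rot_degree_ge1 : degree_ge1 (rotp N r j).
Proof.
have bnd m : m %% r < N by apply: leq_trans rN; rewrite ltn_mod.
have partner (k : 'I_N) : r <= k -> exists l : 'I_N,
    [/\ r <= l, k != l & (k - r)./2 = (l - r)./2].
  move=> rk; have kN := ltn_ord k.
  have [l [lN rl nkl kl]] : exists l, [/\ l < N, r <= l, nat_of_ord k <> l &
      (k - r)./2 = (l - r)./2].
    have [od|od] := boolP (odd (k - r)).
      by exists k.-1; split; lia.
    by exists k.+1; split; lia.
  by exists (Ordinal lN); split => //; apply/eqP => /(congr1 val).
case=> k; have [kr|rk] := ltnP k r.
- exists (inr (Ordinal (bnd (k + j)))) => //.
  by rewrite in_kernel /= kr ltn_mod r0.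
- have [l [rl nkl kl]] := partner k rk; exists (inl l) => //.
  by rewrite in_kernel /= !ifF ?kl //; lia.
- exists (inl (Ordinal (bnd (k + (r - j %% r))))) => //.
  have E : k + (r - j %% r) + j = (j %/ r).+1 * r + k.
    have jr : j %% r <= r by rewrite ltnW // ltn_mod.
    by rewrite {2}(divn_eq j r) mulSn; lia.
  by rewrite in_kernel /= kr ltn_mod r0 /= modnDml E modnMDl modn_small.
- have [l [rl nkl kl]] := partner k rk; exists (inr l) => //.
  by rewrite in_kernel /= !ifF ?kl //; lia.
Qed.

End Degrees.

(** * Arcs in the annulus *)

Import Order.TTheory GRing.Theory Num.Theory numFieldNormedType.Exports.
Local Open Scope ring_scope.
Local Open Scope classical_set_scope.

Section Arcs.
Variable R : realType.
Notation C := (cplx R).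
Implicit Types (a b z w : C) (g h : R -> C) (D : set C) (t : R).

Definition rc (x : R) : C := (x%:C)%C.

Lemma norm_rc x : `|rc x| = rc `|x|.
Proof. by rewrite /rc normc_def /= expr0n addr0 sqrtr_sqr. Qed.

Lemma rc_continuous : continuous rc.
Proof.
move=> x; apply/cvgrPdist_lt => e e0.
have [Re0 eE] : 0 < complex.Re e /\ e = rc (complex.Re e).
  by move: e0; case: (e) => a b; rewrite ltcE /= => /andP[/eqP -> ?]; split.
near=> y; rewrite -rmorphB -/(rc _) norm_rc eE ltcR.
near: y; by apply: (@cvgr_dist_lt _ R^o).
Unshelve. all: by end_near.
Qed.

Lemma norm_expi t : `|@expi R t| = 1.
Proof. by rewrite /expi normc_def /= cos2Dsin2 sqrtr1. Qed.

Lemma expi_continuous : continuous (@expi R).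
Proof.
have E : @expi R = fun t => rc (cos t) + 'i%C * rc (sin t).
  apply/funext => t; rewrite /expi /rc; apply/eqP; rewrite eq_complex /=.
  by rewrite ?(mul0r, mul1r, mulr0, subr0, addr0, add0r, oppr0) !eqxx.
rewrite E => t; apply: cvgD.
  by apply: continuous_comp; [exact: continuous_cos|exact: rc_continuous].
apply: cvgM; first exact: cvg_cst.
by apply: continuous_comp; [exact: continuous_sin|exact: rc_continuous].
Qed.

Lemma expi_inj s t : 0 <= s < 2 * pi -> 0 <= t < 2 * pi -> @expi R s = expi t -> s = t.
Proof.
wlog st : s t / s <= t.
  by move=> wl hs ht E; have [st|/ltW ts] := leP s t; [exact: wl|apply/esym/wl].
move=> /andP[s0 s2] /andP[t0 t2] [ec es].
have c1 : cos (t - s) = 1 by rewrite cosB ec es -!expr2 cos2Dsin2.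
have [->//|nst] := eqVneq s t; have lst : s < t by rewrite lt_neqAle nst.
have sin0 : 0 < sin ((t - s) / 2).
  by apply: sin_gt0_pi; apply/andP; split; lra.
have : cos ((t - s) / 2 *+ 2) = 1 by rewrite -mulr_natr divfK.
by rewrite cos_mulr2n; have := cos2Dsin2 ((t - s)/2); nra.
Qed.

(** A retraction of the line onto the unit interval. Composing with it makes strings
   continuous everywhere, so that they can be reparametrised and concatenated without
   attention to the domain. *)
Definition clamp t : R := (`|t| - `|t - 1| + 1) / 2.

Lemma clamp_id t : 0 <= t <= 1 -> clamp t = t.
Proof.
by move=> /andP[t0 t1]; rewrite /clamp ger0_norm // ler0_norm; lra.
Qed.

Lemma clamp_le0 t : t <= 0 -> clamp t = 0.
Proof. by move=> t0; rewrite /clamp ler0_norm // ler0_norm; lra. Qed.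

Lemma clamp_ge1 t : 1 <= t -> clamp t = 1.
Proof. by move=> t1; rewrite /clamp ger0_norm ?ger0_norm; lra. Qed.

Lemma clamp_itv t : 0 <= clamp t <= 1.
Proof.
have [t0|t0] := leP t 0; first by rewrite clamp_le0 //; lra.
have [t1|t1] := leP t 1; first by rewrite clamp_id; lra.
by rewrite clamp_ge1; lra.
Qed.

Lemma clamp_continuous : continuous clamp.
Proof.
move=> t; apply: cvgM; last exact: cvg_cst.
apply: cvgD; last exact: cvg_cst.
apply: cvgB; apply: cvg_norm; first exact: cvg_id.
by apply: cvgB; [exact: cvg_id|exact: cvg_cst].
Qed.

Lemma continuous_clamp g : {within `[0, 1], continuous g} -> continuous (g \o clamp).
Proof.
move=> /subspace_continuousP cg t.
have tI : `[0, 1]%classic (clamp t) by rewrite /= in_itv; apply: clamp_itv.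
apply: (@cvg_comp _ _ _ clamp g (nbhs t) (within `[0, 1] (nbhs (clamp t)))); last first.
  exact: (cg _ tI).
move=> A nA; rewrite -[_ A]/(nbhs t (clamp @^-1` A)).
have : nbhs t (clamp @^-1` [set y | `[0, 1]%classic y -> A y]) := @clamp_continuous t _ nA.
apply: filterS => u uA; apply: uA.
by rewrite /= in_itv; apply: clamp_itv.
Qed.

(** [D] is a region that contains the path, including its ends. *)
Definition arc a b D g :=
  [/\ continuous g, g 0 = a, g 1 = b,
      forall t, 0 < t < 1 -> annulus (g t) & forall t, D (g t)].

Lemma arc_rev a b D g : arc a b D g -> exists h, arc b a D h.
Proof.
move=> [cg g0 g1 ga gD]; exists (fun t => g (1 - t)); split.
- move=> t; apply: continuous_comp; last exact: cg.
  by apply: cvgB; [exact: cvg_cst|exact: cvg_id].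
- by rewrite subr0.
- by rewrite subrr.
- by move=> t t01; apply: ga; lra.
- by move=> t; apply: gD.
Qed.

Lemma arc_cat a b c D g h : annulus b -> arc a b D g -> arc b c D h ->
  exists k, arc a c D k.
Proof.
move=> bA [cg g0 g1 ga gD] [ch h0 h1 ha hD].
(* one of the two moving terms is constantly [b] = [h 0] at any time *)
pose k t := g (clamp (2 * t)) + h (clamp (2 * t - 1)) - h 0.
have kl t : t <= 2^-1 -> k t = g (clamp (2 * t)).
  by move=> tl; rewrite /k (@clamp_le0 (2 * t - 1)) ?addrK //; lra.
have kr t : 2^-1 <= t -> k t = h (clamp (2 * t - 1)).
  by move=> tl; rewrite /k (@clamp_ge1 (2 * t)) ?g1 ?h0 1?addrC ?addKr //; lra.
have k2 (t : R) : {for t, continuous (fun t : R => 2 * t)}.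
  by apply: cvgM; [exact: cvg_cst|exact: cvg_id].
exists k; split.
- move=> t; apply: cvgB; last exact: cvg_cst.
  apply: cvgD.
    apply: continuous_comp; last exact: cg.
    by apply: continuous_comp; [exact: k2|exact: clamp_continuous].
  apply: continuous_comp; last exact: ch.
  apply: continuous_comp; last exact: clamp_continuous.
  by apply: cvgB; [exact: k2|exact: cvg_cst].
- by rewrite kl ?clamp_id ?mulr0 //; lra.
- have -> : k 1 = h (clamp (2 * 1 - 1)) by apply: kr; lra.
  by rewrite clamp_ge1 //; lra.
- move=> t /andP[t0 t1].
  have [tl|tl] := ltP t 2^-1.
    by rewrite kl ?clamp_id; [apply: ga|..]; lra.
  have [->|tn] := eqVneq t 2^-1.
    by rewrite kl // mulfV // clamp_id ?g1 //; lra.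
  have tg : 2^-1 < t by rewrite lt_neqAle eq_sym tn.
  have -> : k t = h (2 * t - 1) by rewrite kr ?clamp_id //; lra.
  by apply: ha; lra.
- by move=> t; have [tl|/ltW tl] := leP t 2^-1; [rewrite kl|rewrite kr].
Qed.

Definition modulus z : R := complex.Re `|z|.

Lemma norm_modulus z : `|z| = rc (modulus z).
Proof. by rewrite /modulus /rc normc_def. Qed.

Lemma rc1 : rc 1 = 1. Proof. by []. Qed.

Lemma rc2 : rc 2 = 2. Proof. by rewrite /rc rmorph_nat. Qed.

Lemma annulusE z : annulus z = (1 < modulus z < 2) :> Prop.
Proof. by rewrite /annulus /= norm_modulus -rc1 -rc2 !ltcR. Qed.

Lemma modulus_expi t : modulus (expi t) = 1.
Proof. by rewrite /modulus norm_expi. Qed.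

Lemma modulusM (c : R) z : 0 <= c -> modulus (rc c * z) = c * modulus z.
Proof.
by move=> c0; rewrite /modulus normrM norm_rc (ger0_norm c0) norm_modulus -rmorphM.
Qed.

(** The radial map that halves the width of an annulus: it takes the modulus [m] to
   [c + m / 2]. With [c] = 1/2 and [c] = 1 it maps the annulus onto its inner and its
   outer half. *)
Definition narrow (c : R) z : C := rc (c / modulus z + 2^-1) * z.

Lemma modulus_narrow c z : 0 < c -> 1 <= modulus z ->
  modulus (narrow c z) = c + modulus z / 2.
Proof.
move=> c0 z1; have z0 : 0 < modulus z by apply: lt_le_trans z1.
rewrite modulusM; first by field; rewrite gt_eqF.
by rewrite addr_ge0 ?mulr_ge0 ?invr_ge0 ?ltW // ltr0n.
Qed.

Lemma narrow_inj c z w : 0 < c -> 1 <= modulus z -> 1 <= modulus w ->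
  narrow c z = narrow c w -> z = w.
Proof.
move=> c0 z1 w1 E; have zw : modulus z = modulus w.
  by have := congr1 modulus E; rewrite !modulus_narrow //; lra.
move: E; rewrite /narrow zw; apply: mulfI.
have w0 : 0 < modulus w by apply: lt_le_trans w1.
rewrite -[0]/(rc 0) (inj_eq (@complexI R)) gt_eqF //.
by rewrite ltr_wpDl ?invr_gt0 ?ltr0n // mulr_ge0 ?invr_ge0 ?ltW.
Qed.

Lemma narrow_continuous c z : 1 <= modulus z -> {for z, continuous (narrow c)}.
Proof.
move=> z1; have z0 : `|z| != 0.
  rewrite norm_modulus -[0]/(rc 0) (inj_eq (@complexI R)) gt_eqF //.
  exact: lt_le_trans z1.
have -> : narrow c = fun z : C => (rc c * `|z|^-1 + rc 2^-1) * z.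
  apply/funext => w; rewrite /narrow norm_modulus; congr (_ * _).
  by rewrite /rc rmorphD rmorphM fmorphV.
have FF : ProperFilter (nbhs z) by exact: nbhs_pfilter.
apply: (@cvgM C C (nbhs z) FF _ (fun z : C => z)); last exact: cvg_id.
apply: (@cvgD C C C (nbhs z) FF); last exact: cvg_cst.
apply: (@cvgM C C (nbhs z) FF); first exact: cvg_cst.
apply: (@cvgV C C (nbhs z) FF) => //.
exact: norm_continuous.
Qed.

End Arcs.

(** * Drawings of partitions *)

Section Nodes.
Variables (R : realType) (n : nat).
Notation C := (cplx R).
Implicit Types (k l : 'I_n) (x y : vertex n) (v w : vertex3 n) (z : C).

Definition spoke k : C := expi (2 * pi * k%:R / n%:R).

Lemma modulus_spoke k : modulus (spoke k) = 1.
Proof. exact: modulus_expi. Qed.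

Lemma spoke_inj : injective spoke.
Proof.
have itv k : 0 <= (2 * pi * k%:R / n%:R : R) < 2 * pi.
  have n0 : (0 < n%:R :> R) by rewrite ltr0n; case: n k => // -[].
  have pi0 := pi_gt0 R.
  rewrite divr_ge0 ?mulr_ge0 ?ler0n ?(ltW pi0) //= ltr_pdivrMr //.
  by rewrite ltr_pM2l ?mulr_gt0 // ltr_nat.
move=> k l /expi_inj - /(_ (itv k) (itv l)) E; apply/val_inj/eqP.
have n0 : (n%:R != 0 :> R) by rewrite pnatr_eq0; case: (n) k {E l} => // -[].
have pi0 : (2 * pi != 0 :> R) by rewrite mulf_neq0 ?gt_eqF ?pi_gt0.
by move: E => /(mulIf (invr_neq0 n0)) /(mulfI pi0) /eqP; rewrite eqr_nat.
Qed.

Lemma modulus_node x : modulus (node R x) = if x is inl _ then 1 else 2.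
Proof.
case: x => k /=; first exact: modulus_expi.
by rewrite -rc2 modulusM ?modulus_expi ?mulr1.
Qed.

(** The middle vertices are placed on the circle of radius 3/2, where the two halves
   of the annulus meet. *)
Definition node3 v : C :=
  match v with
  | inl (inl k) => spoke k
  | inl (inr k) => rc (3 / 2) * spoke k
  | inr k => rc 2 * spoke k
  end.

Lemma node3_outer x : node3 (outer x) = node R x.
Proof. by case: x => //= k; rewrite rc2. Qed.

Lemma narrow_upper x : narrow (2^-1) (node R x) = node3 (upper x).
Proof.
rewrite /narrow modulus_node; case: x => k /=.
  rewrite (_ : _ + _ = 1) ?mul1r //; lra.
by rewrite mulrA -rc2 -rmorphM; congr (rc _ * _); lra.
Qed.

Lemma narrow_lower x : narrow 1 (node R x) = node3 (lower x).
Proof.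
rewrite /narrow modulus_node; case: x => k /=.
  by congr (rc _ * _); lra.
by rewrite mulrA -rc2 -rmorphM; congr (rc _ * _); lra.
Qed.

End Nodes.
Section Diagrams.
Variables (R : realType) (n : nat).
Notation C := (cplx R).
Implicit Types (x y : vertex n) (v w : vertex3 n) (z : C) (g : R -> C).

Lemma string_norm x y g t : is_string x y g -> 0 <= t <= 1 -> 1 <= modulus (g t) <= 2.
Proof.
move=> [_ g0 g1 ga] /andP[t0 t1].
have nn (u : vertex n) : 1 <= modulus (node R u) <= 2.
  by rewrite modulus_node; case: u => _; lra.
have [->|nt0] := eqVneq t 0; first by rewrite g0.
have [->|nt1] := eqVneq t 1; first by rewrite g1.
have : annulus (g t) by apply: ga; rewrite !lt_neqAle t0 t1 nt1 eq_sym nt0.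
by rewrite annulusE => /andP[/ltW -> /ltW ->].
Qed.

Lemma string_boundary x y g t : is_string x y g -> 0 <= t <= 1 ->
  modulus (g t) = 1 \/ modulus (g t) = 2 -> g t = node R x \/ g t = node R y.
Proof.
move=> [_ g0 g1 ga] /andP[t0 t1] nt.
have [->|nt0] := eqVneq t 0; first by left.
have [->|nt1] := eqVneq t 1; first by right.
have : annulus (g t) by apply: ga; rewrite !lt_neqAle t0 t1 nt1 eq_sym nt0.
by rewrite annulusE => /andP[]; case: nt => ->; rewrite ltxx.
Qed.

Lemma string_arc x y g : is_string x y g ->
  arc (node R x) (node R y) (trace g) (g \o clamp (R := R)).
Proof.
move=> [cg g0 g1 ga]; split.
- exact: continuous_clamp.
- by rewrite /= clamp_id ?g0 // lexx ler01.
- by rewrite /= clamp_id ?g1 // lexx ler01.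
- by move=> t t01; rewrite /= clamp_id; [apply: ga|case/andP: t01 => /ltW -> /ltW ->].
- by move=> t; exists (clamp t) => //; rewrite /= in_itv; apply: clamp_itv.
Qed.

Lemma arc_string x y D g : arc (node R x) (node R y) D g -> is_string x y g.
Proof. by move=> [cg g0 g1 ga _]; split => //; apply: continuous_subspaceT. Qed.

Lemma arc_trace a b D g : arc a b D g -> trace g `<=` D.
Proof. by move=> [_ _ _ _ gD] _ [t _ <-]. Qed.

(** A choice of strings for all pairs of distinct linked points, in either
   order. *)
Definition drawing (p : partition_sg n) (d : vertex n -> vertex n -> R -> C) : Prop :=
  (forall x y, (x, y) \in val p -> x != y -> is_string x y (d x y)) /\
  (forall x y x' y', (x, y) \in val p -> x != y -> (x', y') \in val p -> x' != y' ->
     (x, x') \notin val p -> trace (d x y) `&` trace (d x' y') = set0).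

Lemma string_rev x y g : is_string x y g ->
  exists2 h, is_string y x h & trace h `<=` trace g.
Proof.
move=> /string_arc/arc_rev[h ha]; exists h; first exact: arc_string ha.
exact: arc_trace ha.
Qed.

Lemma block_eq (p : partition_sg n) x : [set y | (x, y) \in val p]%SET \in blocks p.
Proof. by apply/blocksP; exists x. Qed.

Lemma block_pair (p : partition_sg n) x y : degree_le1 p -> (x, y) \in val p -> x != y ->
  [set y | (x, y) \in val p]%SET = [set x; y]%SET.
Proof.
move=> d1 xy nxy; apply/setP => z; rewrite finset.in_set finset.in_set2.
apply/idP/orP => [xz|[]/eqP-> //]; last exact: ptn_refl.
have [->|nxz] := eqVneq z x; [by left|right; apply/eqP].
by apply: d1 xz xy _ nxy; rewrite eq_sym.
Qed.

(** A block determines its two points up to their order, and strings can be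
   reversed. *)
Lemma annular_drawing (p : partition_sg n) : degree_le1 p ->
  is_annular R p <-> exists d, drawing p d.
Proof.
move=> d1; split=> [[d0 [dd dn]]|[d [ds dn]]].
  pose B x := [set y | (x, y) \in val p]%SET.
  have B2 x y : (x, y) \in val p -> x != y -> #|B x| = 2%N.
    by move=> xy nxy; rewrite /B (block_pair d1 xy nxy) cards2 nxy.
  have /choice[d dP] (xy : vertex n * vertex n) : exists g,
      (xy \in val p) -> xy.1 != xy.2 ->
      is_string xy.1 xy.2 g /\ trace g `<=` trace (d0 (B xy.1)).
    case: xy => x y /=; have [[xy nxy]|no] := pselect ((x, y) \in val p /\ x != y);
      last by exists (fun=> 0) => xy nxy; case: no.
    have [x' [y' [nxy' BE st]]] := dd (B x) (block_eq p x) (B2 _ _ xy nxy).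
    have : (x == x') && (y == y') || (x == y') && (y == x').
      have := BE; rewrite /B (block_pair d1 xy nxy) => E.
      have : x \in [set x'; y']%SET by rewrite -E finset.in_set2 eqxx.
      have : y \in [set x'; y']%SET by rewrite -E finset.in_set2 eqxx orbT.
      rewrite !finset.in_set2 => /orP[]/eqP yE /orP[]/eqP xE; rewrite xE yE ?eqxx ?orbT //.
        by rewrite xE yE eqxx in nxy.
      by rewrite xE yE eqxx in nxy.
    case/orP => /andP[/eqP xE /eqP yE].
      by exists (d0 (B x)) => _ _; rewrite xE yE in st *; split.
    by have [h hs ht] := string_rev st; exists h => _ _; rewrite xE yE in hs ht *; split.
  exists (fun x y => d (x, y)); split=> [x y xy nxy|x y x' y' xy nxy xy' nxy' nxx'].
    by have [] := dP (x, y) xy nxy.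
  have [_ t1] := dP (x, y) xy nxy; have [_ t2] := dP (x', y') xy' nxy'.
  rewrite -subset0 -(dn (B x) (B x')) ?block_eq ?(B2 _ _ xy nxy) ?(B2 _ _ xy' nxy') //.
    by move=> z [z1 z2]; split; [apply: t1|apply: t2].
  apply: contraNneq nxx' => E; have : x' \in B x' by rewrite finset.in_set ptn_refl.
  by rewrite -E finset.in_set.
have /choice[e eP] (B : {set vertex n}) : exists g,
    B \in blocks p -> #|B| = 2%N ->
    exists x y, [/\ x != y, B = [set x; y]%SET, (x, y) \in val p & g = d x y].
  have [[Bp B2]|no] := pselect (B \in blocks p /\ #|B| = 2%N); last first.
    by exists (fun=> 0) => Bp B2; case: no.
  have /eqP/cards2P[x [y [nxy BE]]] := B2.
  have /blocksP[u BE'] := Bp.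
  have ux : (u, x) \in val p.
    have : x \in B by rewrite BE finset.in_set2 eqxx.
    by rewrite BE' finset.in_set.
  have uy : (u, y) \in val p.
    have : y \in B by rewrite BE finset.in_set2 eqxx orbT.
    by rewrite BE' finset.in_set.
  by exists (d x y) => _ _; exists x, y; split => //; apply: ptn_trans (ptn_sym ux) uy.
exists e; split=> [B Bp B2|B B' Bp Bp' B2 B2' nBB'].
  have [x [y [nxy BE xy ->]]] := eP B Bp B2; exists x, y; split => //.
  exact: ds.
have [x [y [nxy BE xy ->]]] := eP B Bp B2.
have [x' [y' [nxy' BE' xy' ->]]] := eP B' Bp' B2'.
apply: dn => //; apply: contraNN nBB' => xx'.
rewrite BE BE' -(block_pair d1 xy nxy) -(block_pair d1 xy' nxy').
apply/eqP/setP => z; rewrite !finset.in_set; apply/idP/idP => h.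
  exact: ptn_trans (ptn_sym xx') h.
exact: ptn_trans xx' h.
Qed.

End Diagrams.

(** * Stacking drawings *)

Section Stacking.
Variables (R : realType) (n : nat) (p q : partition_sg n).
Notation C := (cplx R).
Variables dp dq : vertex n -> vertex n -> R -> C.
Hypotheses (p1 : degree_le1 p) (q1 : degree_le1 q).
Hypotheses (dpP : drawing p dp) (dqP : drawing q dq).
Implicit Types (x y : vertex n) (v w : vertex3 n) (z : C) (g : R -> C).

(** The points covered by the narrowed strings of all edges in the class of [v]. *)
Definition strand v : set C := [set z |
  (exists x y, [/\ (x, y) \in val p, x != y, linked p q v (upper x) &
     (narrow 2^-1 @` trace (dp x y)) z]) \/
  (exists x y, [/\ (x, y) \in val q, x != y, linked p q v (lower x) &
     (narrow 1 @` trace (dq x y)) z])].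

Let half_gt0 : 0 < 2^-1 :> R.
Proof. by rewrite invr_gt0 ltr0n. Qed.

Lemma trace_norm x y g z : is_string x y g -> trace g z -> 1 <= modulus z <= 2.
Proof.
by move=> sg [t tI <-]; apply: string_norm sg _; move: tI; rewrite /= in_itv.
Qed.

Lemma arc_narrow (c : R) x y g : 0 < c -> c = 2^-1 \/ c = 1 -> is_string x y g ->
  arc (narrow c (node R x)) (narrow c (node R y)) (narrow c @` trace g)
    (narrow c \o (g \o clamp (R := R))).
Proof.
move=> c0 c12 sg; have [cg g0 g1 ga gD] := string_arc sg; split.
- move=> t; apply: continuous_comp; first exact: cg.
  by apply: narrow_continuous; have /andP[] := trace_norm sg (gD t).
- by rewrite -g0.
- by rewrite -g1.
- move=> t t01; have := ga t t01; rewrite !annulusE => /andP[n1 n2].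
  rewrite /= modulus_narrow ?(ltW n1) //.
  by case: c12 => ->; apply/andP; split; lra.
- by move=> t; exists ((g \o clamp (R := R)) t) => //; apply: gD.
Qed.

Lemma arc_upper v x y : (x, y) \in val p -> x != y -> linked p q v (upper x) ->
  exists g, arc (node3 R (upper x)) (node3 R (upper y)) (strand v) g.
Proof.
move=> xy nxy vx; have sg := dpP.1 _ _ xy nxy.
have [cg g0 g1 ga gD] := arc_narrow half_gt0 (or_introl erefl) sg.
exists (narrow 2^-1 \o (dp x y \o clamp (R := R))); rewrite -!narrow_upper.
by split => // t; left; exists x, y; split.
Qed.

Lemma arc_lower v x y : (x, y) \in val q -> x != y -> linked p q v (lower x) ->
  exists g, arc (node3 R (lower x)) (node3 R (lower y)) (strand v) g.
Proof.
move=> xy nxy vx; have sg := dqP.1 _ _ xy nxy.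
have [cg g0 g1 ga gD] := arc_narrow ltr01 (or_intror erefl) sg.
exists (narrow 1 \o (dq x y \o clamp (R := R))); rewrite -!narrow_lower.
by split => // t; right; exists x, y; split.
Qed.

Lemma annulus_middle k : annulus (node3 R (inl (inr k) : vertex3 n)).
Proof.
rewrite annulusE modulusM ?modulus_spoke; [apply/andP; split|]; lra.
Qed.

(** The strings along a trail are concatenated. Apart from its two ends the trail only
   visits middle vertices, which lie inside of the annulus. *)
Lemma trail_arc x k s : trail p q x k.+1 = Some s ->
  exists g, arc (node3 R (outer x)) (node3 R s.1) (strand (outer x)) g.
Proof.
elim: k s => [|k IH] s st.
  have xs := trail_linked p1 q1 (erefl (trail p q x 0)).
  have [t [te] [a b ta ab ->|a b ta ab ->]] := trailSP st.
  - have [nab pab] := (mateP a b p1).1 ab.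
    have -> : outer x = upper a by move: ta; rewrite -te => -[].
    apply: arc_upper => //; exact: linked_refl.
  - have [nab pab] := (mateP a b q1).1 ab.
    have -> : outer x = lower a by move: ta; rewrite -te => -[].
    apply: arc_lower => //; exact: linked_refl.
have [t kt tspec] := trailSP st.
have xt := trail_linked p1 q1 kt.
have [g ag] := IH t kt.
have notouter y : t.1 != outer y.
  apply/eqP => ty; have := @trail_stop n p q x k y t.2.
  by rewrite -ty -surjective_pairing => /(_ kt); rewrite st.
have mid : annulus (node3 R t.1).
  case: (t.1) notouter => [[k'|k']|k'] no; [|exact: annulus_middle|].
    by have := no (inl k'); rewrite eqxx.
  by have := no (inr k'); rewrite eqxx.
case: tspec xt ag mid => [a b -> ab ->|a b -> ab ->] /= xt ag mid.
- have [nab pab] := (mateP a b p1).1 ab.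
  have [h ah] := arc_upper pab nab xt.
  exact: arc_cat mid ag ah.
- have [nab pab] := (mateP a b q1).1 ab.
  have [h ah] := arc_lower pab nab xt.
  exact: arc_cat mid ag ah.
Qed.

Lemma trace_eq_linked v w x y x' y' z (r : partition_sg n) d
    (f : vertex n -> vertex3 n) :
  drawing r d -> (forall a b, (a, b) \in val r -> linked p q (f a) (f b)) ->
  (x, y) \in val r -> x != y -> linked p q v (f x) -> trace (d x y) z ->
  (x', y') \in val r -> x' != y' -> linked p q w (f x') -> trace (d x' y') z ->
  linked p q v w.
Proof.
move=> [ds dn] fl xy nxy vx zx xy' nxy' wx zx'.
have [xx'|nxx'] := boolP ((x, x') \in val r).
  apply: linked_trans vx _; apply: linked_trans (fl _ _ xx') _.
  by rewrite linked_sym.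
have := dn _ _ _ _ xy nxy xy' nxy' nxx'; rewrite -subset0 => /(_ z) [].
by split.
Qed.

(** Two strings of the same layer meet only if they belong to the same block. Strings
   of different layers meet only on the circle of radius 3/2; this is the image of the
   boundary, where a string has only its ends, so they meet in a middle vertex. *)
Lemma strand_meet v w z : strand v z -> strand w z -> linked p q v w.
Proof.
have upper_lower v' w' x y x' y' z1 z2 : (x, y) \in val p -> x != y ->
    linked p q v' (upper x) -> trace (dp x y) z1 ->
    (x', y') \in val q -> x' != y' -> linked p q w' (lower x') -> trace (dq x' y') z2 ->
    narrow 2^-1 z1 = narrow 1 z2 -> linked p q v' w'.
  move=> xy nxy vx t1 xy' nxy' wx t2 E.
  have s1 := dpP.1 _ _ xy nxy; have s2 := dqP.1 _ _ xy' nxy'.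
  have /andP[l1 u1] := trace_norm s1 t1; have /andP[l2 u2] := trace_norm s2 t2.
  have NE : 2^-1 + modulus z1 / 2 = 1 + modulus z2 / 2.
    by have := congr1 (@modulus R) E; rewrite !modulus_narrow ?half_gt0 ?ltr01.
  have n1 : modulus z1 = 2 by lra.
  have n2 : modulus z2 = 1 by lra.
  have [u vu z1u] : exists2 u, linked p q v' (upper u) & z1 = node R u.
    case: t1 => t tI zt; have tI' : 0 <= t <= 1 by move: tI; rewrite /= in_itv.
    have [] := string_boundary s1 tI'; first by rewrite zt; right.
      by rewrite zt => ->; exists x.
    by rewrite zt => ->; exists y => //; apply: linked_trans vx _; apply: linked_upper.
  have [u' vu' z2u] : exists2 u, linked p q w' (lower u) & z2 = node R u.
    case: t2 => t tI zt; have tI' : 0 <= t <= 1 by move: tI; rewrite /= in_itv.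
    have [] := string_boundary s2 tI'; first by rewrite zt; left.
      by rewrite zt => ->; exists x'.
    by rewrite zt => ->; exists y' => //; apply: linked_trans wx _; apply: linked_lower.
  move: n1 n2 E; rewrite {}z1u {}z2u !modulus_node narrow_upper narrow_lower.
  have n12 : (1 : R) = 2 -> False by lra.
  case: u vu => k vu; first by move/n12.
  case: u' vu' => l vu'; last by move=> _ /esym/n12.
  move=> _ _ /= /mulfI E; have kl : k = l.
    apply/(@spoke_inj R n)/E; rewrite -[0]/(rc 0) (inj_eq (@complexI R)); lra.
  by apply: linked_trans vu _; rewrite linked_sym kl.
case=> [[x [y [xy nxy vx [z1 t1 <-]]]]|[x [y [xy nxy vx [z1 t1 <-]]]]];
  case=> [[x' [y' [xy' nxy' wx [z2 t2 E]]]]|[x' [y' [xy' nxy' wx [z2 t2 E]]]]].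
- have s1 := dpP.1 _ _ xy nxy; have s2 := dpP.1 _ _ xy' nxy'.
  have /andP[l1 _] := trace_norm s1 t1; have /andP[l2 _] := trace_norm s2 t2.
  rewrite (narrow_inj half_gt0 l2 l1 E) in t2.
  by apply: (trace_eq_linked dpP _ xy nxy vx t1 xy' nxy' wx t2) => a b; apply: linked_upper.
- exact: (upper_lower _ _ _ _ _ _ _ _ xy nxy vx t1 xy' nxy' wx t2).
- rewrite linked_sym.
  exact: (upper_lower _ _ _ _ _ _ _ _ xy' nxy' wx t2 xy nxy vx t1).
- have s1 := dqP.1 _ _ xy nxy; have s2 := dqP.1 _ _ xy' nxy'.
  have /andP[l1 _] := trace_norm s1 t1; have /andP[l2 _] := trace_norm s2 t2.
  rewrite (narrow_inj ltr01 l2 l1 E) in t2.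
  by apply: (trace_eq_linked dqP _ xy nxy vx t1 xy' nxy' wx t2) => a b; apply: linked_lower.
Qed.

Lemma drawing_mul : exists d, drawing (R := R) (p ** q) d.
Proof.
have /choice[d dP] (xy : vertex n * vertex n) : exists g,
    (xy \in val (p ** q)) -> xy.1 != xy.2 ->
    is_string xy.1 xy.2 g /\ trace g `<=` strand (outer xy.1).
  case: xy => x y /=; have [[xy nxy]|no] := pselect ((x, y) \in val (p ** q) /\ x != y);
    last by exists (fun=> 0) => xy nxy; case: no.
  rewrite ptn_mulE in xy.
  have [k [b /trail_arc[g]]] := trail_outer p1 q1 nxy xy.
  rewrite !node3_outer => ag; exists g => _ _; split; first exact: arc_string ag.
  exact: arc_trace ag.
exists (fun x y => d (x, y)); split=> [x y xy nxy|x y x' y' xy nxy xy' nxy' nxx'].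
  by have [] := dP (x, y) xy nxy.
have [_ t1] := dP (x, y) xy nxy; have [_ t2] := dP (x', y') xy' nxy'.
rewrite -subset0 => z [z1 z2]; case/negP: nxx'; rewrite ptn_mulE.
exact: strand_meet (t1 _ z1) (t2 _ z2).
Qed.

End Stacking.

Section Annular.
Variables (R : realType) (n : nat).

Lemma partial_annularP (p : partition_sg n) :
  reflect (degree_le1 p /\ exists d, drawing (R := R) p d) (p \in partial_annular R n).
Proof.
rewrite finset.in_set; apply: (iffP andP) => [[/partial_brauerP d1 /asboolP a]|[d1 a]].
  by split => //; apply/annular_drawing.
by split; [apply/partial_brauerP|apply/asboolP/annular_drawing].
Qed.

Lemma annularP (p : partition_sg n) :
  reflect [/\ degree_le1 p, degree_ge1 p & exists d, drawing (R := R) p d] (p \in annular R n).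
Proof.
rewrite finset.in_set; apply: (iffP andP) => [[/brauerP[d1 d2] /asboolP a]|[d1 d2 a]].
  by split => //; apply/annular_drawing.
by split; [apply/brauerP|apply/asboolP/annular_drawing].
Qed.

Lemma partial_annular_closed : subsemigroup (partial_annular R n).
Proof.
move=> p q /partial_annularP[p1 [dp dpP]] /partial_annularP[q1 [dq dqP]].
by apply/partial_annularP; split; [apply: degree_le1_mul|apply: drawing_mul dpP dqP].
Qed.

Lemma annular_closed : subsemigroup (annular R n).
Proof.
move=> p q /annularP[p1 p2 [dp dpP]] /annularP[q1 q2 [dq dqP]]; apply/annularP; split.
- exact: degree_le1_mul.
- exact: degree_ge1_mul.
- exact: drawing_mul dpP dqP.
Qed.

End Annular.

(** * Drawings in polar coordinates *)

Section Spirals.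
Variables (R : realType) (N : nat).
Hypothesis N0 : (0 < N)%N.
Notation C := (cplx R).

(** It is enough to draw each class of labels once, in either direction. *)
Lemma drawing_kernel (K : eqType) (f : vertex N -> K) (P : K -> R -> C) :
  (forall x y, f x = f y -> x != y ->
     is_string x y (P (f x)) \/ is_string y x (P (f x))) ->
  (forall x y, f x != f y -> trace (P (f x)) `&` trace (P (f y)) = set0) ->
  exists d, drawing (R := R) (kernel f) d.
Proof.
move=> fs fd.
have /choice[d dP] (xy : vertex N * vertex N) : exists g,
    f xy.1 = f xy.2 -> xy.1 != xy.2 ->
    is_string xy.1 xy.2 g /\ trace g `<=` trace (P (f xy.1)).
  case: xy => x y /=; have [[E nxy]|no] := pselect (f x = f y /\ x != y);
    last by exists (fun=> 0) => E nxy; case: no.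
  case: (fs x y E nxy) => st; first by exists (P (f x)) => _ _; split.
  by have [h hs ht] := string_rev st; exists h => _ _; split.
exists (fun x y => d (x, y)); split=> [x y|x y x' y'].
  by rewrite in_kernel => /eqP E nxy; have [] := dP (x, y) E nxy.
rewrite !in_kernel => /eqP E nxy /eqP E' nxy' nxx'.
have [_ t1] := dP (x, y) E nxy; have [_ t2] := dP (x', y') E' nxy'.
rewrite -subset0 -(fd x x' nxx') => z [z1 z2].
by split; [apply: t1|apply: t2].
Qed.

(** The angle is measured in steps from one node to the next. *)
Definition polar (s t : R) : C := rc s * expi (2 * pi * t / N%:R).

Lemma modulus_polar s t : 0 <= s -> modulus (polar s t) = s.
Proof. by move=> s0; rewrite modulusM // modulus_expi mulr1. Qed.

Lemma polar_node (x : vertex N) :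
  node R x = match x with inl k => polar 1 k%:R | inr k => polar 2 k%:R end.
Proof. by case: x => k; rewrite /polar /= ?mul1r // rc2. Qed.

Lemma polar_turn s t : polar s (t + N%:R) = polar s t.
Proof.
rewrite /polar; have -> : 2 * pi * (t + N%:R) / N%:R = 2 * pi * t / N%:R + pi *+ 2 :> R.
  rewrite -mulr_natr; field.
  by rewrite pnatr_eq0 -lt0n.
by rewrite /expi cosD2pi sinD2pi.
Qed.

Lemma polarM s s' t t' : polar s t * polar s' t' = polar (s * s') (t + t').
Proof.
rewrite /polar mulrACA -rmorphM; congr (_ * _).
have -> : 2 * pi * (t + t') / N%:R = 2 * pi * t / N%:R + 2 * pi * t' / N%:R :> R.
  by rewrite mulrDr mulrDl.
move: (2 * pi * t / _) (2 * pi * t' / _) => u v.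
by rewrite /expi cosD sinD; apply/eqP; rewrite eq_complex /= eqxx /= addrC.
Qed.

Lemma polar_inj s s' t t' : 0 < s -> 0 < s' -> 0 <= t < N%:R -> 0 <= t' < N%:R ->
  polar s t = polar s' t' -> s = s' /\ t = t'.
Proof.
move=> s0 s0' /andP[t0 tN] /andP[t0' tN'] E; have ss : s = s'.
  by have := congr1 (@modulus R) E; rewrite !modulus_polar ?ltW.
split=> //; move: E; rewrite /polar ss => /mulfI E.
have Npos : (0 < N%:R :> R) by rewrite ltr0n.
have pi2 : (0 < 2 * pi :> R) by rewrite mulr_gt0 ?pi_gt0.
have itv u : 0 <= u -> u < N%:R -> 0 <= (2 * pi * u / N%:R : R) < 2 * pi.
  move=> u0 uN; rewrite divr_ge0 ?mulr_ge0 ?ler0n ?pi_ge0 //= ltr_pdivrMr //.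
  by rewrite ltr_pM2l.
have : 2 * pi * t / N%:R = 2 * pi * t' / N%:R :> R.
  apply: expi_inj; rewrite ?itv //; apply: E.
  by rewrite -[0]/(rc 0) (inj_eq (@complexI R)) gt_eqF.
move=> /(mulIf (invr_neq0 (lt0r_neq0 Npos))) /mulfI; apply.
by rewrite gt_eqF.
Qed.

Lemma polar_string (x y : vertex N) (s t : R -> R) : continuous s -> continuous t ->
  polar (s 0) (t 0) = node R x -> polar (s 1) (t 1) = node R y ->
  (forall u, 0 < u < 1 -> 1 < s u < 2) ->
  is_string x y (fun u => polar (s u) (t u)).
Proof.
move=> cs ct E0 E1 s12; split => //; last first.
  move=> u u01; have /andP[s1 s2] := s12 u u01.
  by rewrite annulusE modulus_polar ?s1 // ltW // (lt_trans ltr01).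
apply: continuous_subspaceT => u; apply: cvgM.
  by apply: continuous_comp; [exact: cs|exact: rc_continuous].
apply: (continuous_comp (f := fun u => 2 * pi * t u / N%:R)); last exact: expi_continuous.
apply: cvgM; last exact: cvg_cst.
by apply: cvgM; [exact: cvg_cst|exact: ct].
Qed.

(** The strings are spirals. At equal moduli two of them are at the same time, and
   their angles differ by the constant angle of their starting points. *)
Lemma rotation_drawing : exists d, drawing (R := R) (rotp N N 1) d.
Proof.
pose P (a : nat * nat) (u : R) := polar (1 + u) (a.2%:R - 1 + u).
have c1 (a : R) : continuous (fun u : R => a + u).
  by move=> u; apply: cvgD; [exact: cvg_cst|exact: cvg_id].
apply: (@drawing_kernel _ (rot_label N 1) P).
  have st (k l : 'I_N) : rot_label N 1 (inl k) = rot_label N 1 (inr l) ->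
      is_string (inl k) (inr l) (P (rot_label N 1 (inr l))).
    rewrite /= !ltn_ord => -[kl]; apply: polar_string => //.
    - rewrite polar_node !addr0 -kl.
      have [kN|kN] := ltnP (k + 1) N.
        by rewrite modn_small // natrD addrK.
      have k1 : (k + 1 = N)%N by have := ltn_ord k; lia.
      rewrite k1 modnn -polar_turn; congr polar.
      by rewrite -{1}k1 natrD mulr0n; ring.
    - by rewrite polar_node; congr polar; ring.
    - by move=> u u01; lra.
  case=> [k|k] [l|l] E nxy.
  - move: E; rewrite /= !ltn_ord => -[] /eqP.
    rewrite eqn_modDr => E; move: E nxy; rewrite modn_small // modn_small // => /eqP/val_inj ->.
    by rewrite eqxx.
  - by left; rewrite E; apply: st.
  - by right; apply: st.
  - by move: E nxy; rewrite /= !ltn_ord => -[/val_inj ->]; rewrite eqxx.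
have lab (x : vertex N) : exists2 j, (j < N)%N & rot_label N 1 x = (0%N, j).
  case: x => k; last by exists k; [exact: ltn_ord|rewrite /= ltn_ord].
  by exists ((k + 1) %% N)%N; [rewrite ltn_mod|rewrite /rot_label ltn_ord].
move=> x y; have [j jN ->] := lab x; have [l lN ->] := lab y => njl.
rewrite -subset0 => z [[u uI <-] [v vI E]].
move: uI vI; rewrite /= !in_itv /= => /andP[u0 u1] /andP[v0 v1].
have uv : u = v.
  have := congr1 (@modulus R) E; rewrite !modulus_polar; lra.
case/eqP: njl; congr pair.
move: E; rewrite /P uv /= => /(congr1 (fun z => z * polar 1 (1 - v))).
have turn w m : polar w (m%:R - 1 + v) * polar 1 (1 - v) = polar w m%:R.
  rewrite polarM; congr polar; ring.
rewrite !turn => /polar_inj E'; apply/eqP; rewrite -(eqr_nat R); apply/eqP.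
by apply: (esym (E' _ _ _ _).2); rewrite ?ler0n ?ltr_nat //; lra.
Qed.

(** The through strings are straight, and the two hooks are flat bumps on the inner and
   the outer circle between the angles of the last two nodes. *)
Lemma hook_drawing : (2 < N)%N -> exists d, drawing (R := R) (rotp N (N - 2) 0) d.
Proof.
move=> N2.
pose P (a : nat * nat) (u : R) := match a.1 with
  | 0%N => polar (1 + u) a.2%:R
  | 1%N => polar (1 + u * (1 - u)) ((N - 2)%:R + u)
  | _ => polar (2 - u * (1 - u)) ((N - 2)%:R + u)
  end.
have cid : continuous (fun u : R => u) by move=> u; exact: cvg_id.
have cc (a : R) : continuous (fun _ : R => a) by move=> u; exact: cvg_cst.
have c1 (a : R) : continuous (fun u : R => a + u).
  by move=> u; apply: cvgD; [exact: cvg_cst|exact: cvg_id].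
have cp : continuous (fun u : R => u * (1 - u)).
  move=> u; apply: cvgM; first exact: cvg_id.
  by apply: cvgB; [exact: cvg_cst|exact: cvg_id].
have cpD (a : R) : continuous (fun u : R => a + u * (1 - u)).
  by move=> u; apply: cvgD; [exact: cvg_cst|exact: cp].
have cpB (a : R) : continuous (fun u : R => a - u * (1 - u)).
  by move=> u; apply: cvgB; [exact: cvg_cst|exact: cp].
have bump (u : R) : 0 <= u <= 1 -> 0 <= u * (1 - u) <= 4^-1.
  move=> /andP[u0 u1]; apply/andP; split; first by apply: mulr_ge0; lra.
  by have := sqr_ge0 (u - 2^-1); rewrite expr2; nra.
have bump' (u : R) : 0 < u < 1 -> 0 < u * (1 - u) < 1.
  move=> /andP[u0 u1]; have /andP[_] : 0 <= u * (1 - u) <= 4^-1.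
    by apply: bump; rewrite !ltW.
  have pos : 0 < u * (1 - u) by apply: mulr_gt0; lra.
  by move=> le4; rewrite pos /=; lra.
have NE : N%:R = (N - 2)%:R + 2 :> R by rewrite -natrD subnK // ltnW.
have topE (k : 'I_N) : (N - 2 <= k)%N ->
    (k = (N - 2)%N :> nat) \/ (k = (N - 2 + 1)%N :> nat).
  by have := ltn_ord k; lia.
apply: (@drawing_kernel _ (rot_label (N - 2) 0) P).
  have through (k l : 'I_N) : rot_label (N - 2) 0 (inl k) = rot_label (N - 2) 0 (inr l) ->
      is_string (inl k) (inr l) (P (rot_label (N - 2) 0 (inr l))).
    rewrite /=; case: ltnP => kN; case: ltnP => lN // -[kl].
    have {}kl : k = l by apply: val_inj; rewrite /= -kl addn0 modn_small.
    rewrite kl; apply: polar_string => //.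
    - by rewrite polar_node addr0.
    - by rewrite polar_node.
    - by move=> u u01; lra.
  have top (k l : 'I_N) : k = (N - 2)%N :> nat -> l = (N - 2 + 1)%N :> nat ->
      is_string (inl k) (inl l) (P (1%N, 0%N)).
    move=> kE lE; apply: polar_string => //.
    - by rewrite polar_node kE mul0r !addr0.
    - by rewrite polar_node lE subrr mulr0 addr0 natrD.
    - by move=> u /bump' /andP[b0 b1]; apply/andP; split; lra.
  have bot (k l : 'I_N) : k = (N - 2)%N :> nat -> l = (N - 2 + 1)%N :> nat ->
      is_string (inr k) (inr l) (P (2%N, 0%N)).
    move=> kE lE; apply: polar_string => //.
    - by rewrite polar_node kE mul0r subr0 addr0.
    - by rewrite polar_node lE subrr mulr0 subr0 natrD.
    - by move=> u /bump' /andP[b0 b1]; apply/andP; split; lra.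
  have half1 : (N - 2 + 1 - (N - 2))./2 = 0%N by rewrite addKn.
  case=> [k|k] [l|l] E nxy; last first.
  - have nkl : nat_of_ord k <> l by move=> /val_inj kl; rewrite kl eqxx in nxy.
    move: E; rewrite /=; case: (ltnP k _) => kN; case: (ltnP l _) => lN // -[kl] //.
    have [kE|kE] := topE k kN; have [lE|lE] := topE l lN; try by rewrite kE lE in nkl.
      by left; rewrite kE subnn; apply: bot.
    by right; rewrite kE half1; apply: bot.
  - by right; apply: through.
  - by left; rewrite E; apply: through.
  have nkl : nat_of_ord k <> l by move=> /val_inj kl; rewrite kl eqxx in nxy.
  move: E; rewrite /=; case: (ltnP k _) => kN; case: (ltnP l _) => lN // -[kl] //.
    by move: kl; rewrite !addn0 !modn_small.
  have [kE|kE] := topE k kN; have [lE|lE] := topE l lN; try by rewrite kE lE in nkl.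
    by left; rewrite kE subnn; apply: top.
  by right; rewrite kE half1; apply: top.
have lab (x : vertex N) : [\/ exists2 j, (j < N - 2)%N & rot_label (N - 2) 0 x = (0%N, j),
    rot_label (N - 2) 0 x = (1%N, 0%N) | rot_label (N - 2) 0 x = (2%N, 0%N)].
  have half k : (N - 2 <= k)%N -> (k < N)%N -> (k - (N - 2))./2 = 0%N by lia.
  case: x => k; rewrite /=; case: ltnP => kN.
  - by constructor 1; exists (k : nat); rewrite ?addn0 ?modn_small.
  - by constructor 2; rewrite half.
  - by constructor 1; exists (k : nat).
  - by constructor 3; rewrite half.
have meet00 (j l : nat) (u v : R) : (j < N - 2)%N -> (l < N - 2)%N -> 0 <= u -> 0 <= v ->
    polar (1 + u) j%:R = polar (1 + v) l%:R -> j = l.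
  move=> jN lN u0 v0 /polar_inj E; apply/eqP; rewrite -(eqr_nat R); apply/eqP.
  have jN' : (j < N)%N by lia. have lN' : (l < N)%N by lia.
  by apply: (E _ _ _ _).2; rewrite ?ler0n ?ltr_nat //; lra.
have meet0h (j : nat) (s u v : R) : (j < N - 2)%N -> 0 <= u -> 1 <= s -> 0 <= v <= 1 ->
    polar (1 + u) j%:R = polar s ((N - 2)%:R + v) -> False.
  move=> jN u0 s1 /andP[v0 v1] /polar_inj E.
  have jN' : (j%:R + 1 <= (N - 2)%:R :> R) by rewrite natr1 ler_nat.
  have j0 : 0 <= j%:R :> R by rewrite ler0n.
  have : j%:R = (N - 2)%:R + v by apply: (E _ _ _ _).2; rewrite ?NE; lra.
  by lra.
have meet12 (u v : R) : 0 <= u <= 1 -> 0 <= v <= 1 ->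
    polar (1 + u * (1 - u)) ((N - 2)%:R + u) = polar (2 - v * (1 - v)) ((N - 2)%:R + v) ->
    False.
  move=> /bump /andP[bu0 bu1] /bump /andP[bv0 bv1] /(congr1 (@modulus R)).
  by rewrite !modulus_polar; lra.
move=> x y nxy; rewrite -subset0 => z [[u uI uz] [v vI vz]].
have {}uI : 0 <= u <= 1 by move: uI; rewrite /= in_itv.
have {}vI : 0 <= v <= 1 by move: vI; rewrite /= in_itv.
have /andP[bu0 bu1] := bump u uI; have /andP[bv0 bv1] := bump v vI.
have /andP[u0 u1] := uI; have /andP[v0 v1] := vI.
move: nxy (etrans uz (esym vz)).
case: (lab x) => [[j jN ->]|->|->]; case: (lab y) => [[l lN ->]|->|->]; rewrite /P /= => nxy;
  try (by []); try by rewrite eqxx in nxy.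
- by move=> /meet00 jl; case/eqP: nxy; rewrite jl.
- by move=> /meet0h; apply; rewrite ?jN //; lra.
- by move=> /meet0h; apply; rewrite ?jN //; lra.
- by move=> /esym/meet0h; apply; rewrite ?lN //; lra.
- by move=> /meet12; apply.
- by move=> /esym/meet0h; apply; rewrite ?lN //; lra.
- by move=> /esym/meet12; apply.
Qed.

End Spirals.

Local Close Scope ring_scope.
Local Close Scope classical_set_scope.

(** * The complexity of the annular semigroups *)

Section Generators.
Variables (R : realType) (N : nat).
Hypothesis N2 : (2 < N)%N.

Lemma rotation_annular : rotp N N 1 \in annular R N.
Proof.
have N0 : (0 < N)%N by apply: ltn_trans N2.
apply/annularP; split; last exact: rotation_drawing.
- by apply: rot_degree_le1; rewrite ?leqnn ?subnn.
- by apply: rot_degree_ge1; rewrite ?leqnn ?subnn.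
Qed.

Lemma hook_annular : rotp N (N - 2) 0 \in annular R N.
Proof.
have N0 : (0 < N)%N by apply: ltn_trans N2.
apply/annularP; split; last exact: hook_drawing.
- by apply: rot_degree_le1; lia.
- by apply: rot_degree_ge1; lia.
Qed.
End Generators.

Lemma annular_sub (R : realType) (N : nat) : annular R N \subset partial_annular R N.
Proof.
apply/fintype.subsetP => p /annularP[d1 _ dr]; exact/partial_annularP.
Qed.

Lemma kr_complexity_between (R : realType) (n : nat) (A : {set partition_sg (2 * n - 1)}) :
  (0 < n)%N -> subsemigroup A -> annular R (2 * n - 1) \subset A ->
  A \subset partial_brauer (2 * n - 1) -> kr_complexity A (n - 1).
Proof.
move=> n0 cA /fintype.subsetP AA AB; split=> [|k kA].
  by apply: kr_bound_sub AB cA; apply: kr_bound_partial_brauer; lia.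
have [n1|n1] := leqP n 1; first by rewrite (_ : n - 1 = 0)%N //; lia.
have N2 : (2 < 2 * n - 1)%N by lia.
apply: (kr_bound_annular_lower n1 _ _ kA); apply: AA; first exact: rotation_annular.
have := hook_annular R N2; rewrite (_ : (2 * n - 1 - 2 = 2 * n - 3)%N) //; lia.
Qed.

Theorem theorem4p12 (R : realType) (n : nat) (hn : (0 < n)%N) :
  kr_complexity (partial_annular R (2 * n - 1)%N) (n - 1)%N /\
  kr_complexity (annular R (2 * n - 1)%N) (n - 1)%N.
Proof.
split; apply: (@kr_complexity_between R n) => //.
- exact: partial_annular_closed.
- exact: annular_sub.
- by apply/fintype.subsetP => p /partial_annularP[d1 _]; apply/partial_brauerP.
- exact: annular_closed.
- by apply/fintype.subsetP => p /annularP[d1 _ _]; apply/partial_brauerP.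
Qed.
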